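(* Let $q(z)=\sum_{j=1}^N q_jz^j$ be a polynomial of degree $N\ge 1$ with all $q_j\ge0$ (so $0<q(1)<+\infty$ and $q(0)=0$). Let $b_1,\dots,b_N\in\mathbb{C}$ be all the zeros of the equation $q(z)=q(1)$, and suppose they are all distinct. Let $\Phi$ be the analytic solution in the open unit disc of $$\int_{0}^{+\infty}\Phi\left(z\,e^{r(q(z)-q(1))}\right)dr=\frac{\Phi(z)}{q(1)}\quad(|z|<1),\qquad \Phi(0)=0,\qquad \Phi'(0)=1,$$ and write $\Phi(z)=\sum_{n\ge1}\varphi_nz^n$. Then for all $n\ge1$ $$\varphi_n=\sum_{\substack{m_1,\dots,m_N\ge0\\ m_1+\dots+m_N=n-1}}\ \prod_{j=1}^N\binom{-1-\frac{q(1)}{q'(b_j)b_j}}{m_j}\left(\frac{-1}{b_j}\right)^{m_j}.$$ Moreover, if exactly one of the $b_j$ equals $1$, say $b_1=1$, and all the others satisfy $|b_j|>1$, then as $n\to+\infty$ $$\varphi_n= C\left(n^{\frac{q(1)}{q'(1)}}+\frac{q(1)\,(q'(1)-q(1))\,(q''(1)+q'(1))}{2\,q'(1)^3}\,n^{\frac{q(1)}{q'(1)}-1}+o\left(n^{\frac{q(1)}{q'(1)}-1}\right)\right),$$ where $$C=\frac{1}{\Gamma\left(1+\frac{q(1)}{q'(1)}\right)}\prod_{j=2}^N\left(1-\frac{1}{b_j}\right)^{-1-\frac{q(1)}{q'(b_j)b_j}}.$$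
   Context: For $\alpha\in\mathbb{C}$ the extended binomial coefficients are $\binom{\alpha}{0}=1$ and $\binom{\alpha}{n}=\frac{\alpha(\alpha-1)\cdots(\alpha-n+1)}{n!}$ for $n\ge1$. Complex powers are $w^{\beta}=\exp(\beta\operatorname{Log} w)$ with the principal branch of the logarithm. $\Gamma$ is Euler's Gamma function. An empty product (case $N=1$) equals $1$. *)

(* Defs.v *)
From Stdlib Require Import Reals.
From Coquelicot Require Import Coquelicot.
From mathcomp Require Import ssreflect ssrfun ssrbool eqtype ssrnat seq choice.
From mathcomp Require Import fintype finfun bigop.

Set Implicit Arguments.
Unset Strict Implicit.
Unset Printing Implicit Defensive.

Open Scope R_scope.

Definition Cexp (z : C) : C :=
  (exp (Re z) * cos (Im z), exp (Re z) * sin (Im z)).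

(* Principal argument, in ]-PI, PI], of a nonzero z; acos takes its values in
   [0, PI].  The value at z = 0 is irrelevant. *)
Definition Carg (z : C) : R :=
  if Rle_dec 0 (Im z) then acos (Re z / Cmod z) else - acos (Re z / Cmod z).

Definition Clog (z : C) : C := (ln (Cmod z), Carg z).

(* w^beta for nonzero w; Coquelicot's Cpow is the power with exponent in nat. *)
Definition Cpower (w beta : C) : C := Cexp (beta * Clog w)%C.

Definition Cbinom (alpha : C) (n : nat) : C :=
  (\big[Cmult/RtoC 1]_(k < n) (alpha - INR k) / INR n`!)%C.

(* Euler's integral; it is the Gamma function for x > 0 only. *)
Definition Gamma (x : R) : R :=
  RInt_gen (fun t : R => Rpower t (x - 1) * exp (- t))
           (at_right 0) (Rbar_locally p_infty).

(* sum of q_j z^j for 1 <= j <= N; the other values of q play no role. *)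
Definition polyR (N : nat) (q : nat -> R) (x : R) : R :=
  sum_n_m (fun j => q j * x ^ j) 1 N.

Definition polyC (N : nat) (q : nat -> R) (z : C) : C :=
  sum_n_m (fun j => (q j * z ^ j)%C) 1 N.

(* The equation on the open unit disc defining Phi; only the values of Phi in
   that disc matter, as |z exp (r (q z - q 1))| <= |z| for r >= 0. *)
Definition analytic_solution (N : nat) (q : nat -> R) (Phi : C -> C) : Prop :=
  [/\ forall z : C, Cmod z < 1 -> ex_derive (K := C_AbsRing) Phi z,
      forall z : C, Cmod z < 1 ->
        is_RInt_gen (V := C_R_NormedModule)
          (fun r : R => Phi (z * Cexp (r * (polyC N q z - polyC N q 1)))%C)
          (at_point 0) (Rbar_locally p_infty)
          (Phi z / polyC N q 1)%C,
      Phi 0 = RtoC 0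
    & is_derive (K := C_AbsRing) Phi (RtoC 0) (RtoC 1)].

(* -1 - q(1) / (q'(b) b) *)
Definition expo (N : nat) (q : nat -> R) (b : C) : C :=
  (- 1 - polyC N q 1 / (C_derive (polyC N q) b * b))%C.

(* Main.v *)
From Stdlib Require Import Reals Lra Lia.
From Coquelicot Require Import Coquelicot.
From HB Require Import structures.
From mathcomp Require Import ssreflect ssrfun ssrbool eqtype ssrnat seq choice.
From mathcomp Require Import fintype finfun bigop.
From mathcomp Require Import ssralg poly polydiv boolp.
From mathcomp Require ring.
Require Import Defs.

Set Implicit Arguments.
Unset Strict Implicit.
Unset Printing Implicit Defensive.

(* Restricting the equation to real z and using the primitive of Phi(w)/w turns it into
   q(1) sum phi_n z^n / n = (q(1) - q(z)) Phi(z), that is, the linear recurrence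
   (n - 1) q(1) phi_n = n sum_j q_j phi_(n-j), which together with phi_1 = 1 determines phi.
   The coefficients of z prod_j (1 - z / b_j)^(al_j), with al_j = -1 - q(1) / (q'(b_j) b_j),
   satisfy the same recurrence: with W = q - q(1), this amounts to the polynomial identity
   z W sum_j al_j / (z - b_j) = - (q(1) + W + z W'), both sides of which have degree at most N
   and agree at the N + 1 points 0, b_1, ..., b_N.

   If b_1 = 1 is the only root in the closed unit disc then al_1 = -1 - s with s = q(1) / q'(1),
   and phi_(k+1) is the convolution of g_k = (s + 1) ... (s + k) / k! with the geometrically
   decaying coefficients of H(z) = prod_(j > 1) (1 - z / b_j)^(al_j). Hence
   phi_(k+1) / g_k = H(1) - s H'(1) / k + o(1 / k), where H(1) is given by the complex binomial
   series and H'(1) / H(1) = sum_(j > 1) al_j / (1 - b_j) is read off the derivative at 1 of the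
   polynomial identity. As 0 < s <= 1, the convexity estimate Gamma(x + s) <= x^s Gamma(x) gives
   g_(n-1) ~ n^s / Gamma(1 + s); the next term follows because g_(n-1) / (n + a)^s is eventually
   monotone for each a, its direction depending on the side of (s - 1) / 2 on which a lies. *)

(** The product of complex powers is never formed as an analytic function on the disc: it is handled
    through polynomials modulo [X^n], where its logarithmic derivative yields the recurrence, so no
    branch has to be followed. Principal powers occur only in H(1), where each 1 - 1 / b_j lies in
    the right half plane and the binomial series decays geometrically. Real z suffice because q has
    real coefficients: z exp(r (q(z) - q(1))) stays real, and the real and imaginary parts of Phi
    satisfy the equation separately. The bound s <= 1 comes from q'(1) = sum_j j q_j >= q(1). It
    allows the convexity estimate to be used with the shift s and with the complementary shift 1 -
    s, which bounds Gamma(k + 1 + s) from both sides. In the second term g contributes s (s - 1) / 2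
    and the convolution - s H'(1) / H(1), with H'(1) / H(1) = (s - 1) (2 q'(1) + q''(1)) / (2
    q'(1)); their sum is the stated coefficient. *)

(** * Formal products and logarithmic derivatives *)

Section FormalProduct.
Import GRing.Theory mathcomp.algebra_tactics.ring.
Local Open Scope ring_scope.

Section Series.
Variable F : comNzRingType.

Definition conv (f g : nat -> F) (n : nat) : F := \sum_(i < n.+1) f i * g (n - i)%N.

Variables (I : Type) (f : I -> nat -> F).

Fixpoint conv_prod (s : seq I) : nat -> F :=
  if s is j :: s' then conv (f j) (conv_prod s') else fun n => (n == 0%N)%:R.

(** Polynomial stand-in for the formal power series product: the coefficients below n are exact. *)
Definition trunc_prod (n : nat) (s : seq I) : {poly F} :=
  \prod_(j <- s) \poly_(i < n) f j i.

Lemma coef_trunc_prod (n : nat) (s : seq I) (k : nat) :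
  (k < n)%N -> (trunc_prod n s)`_k = conv_prod s k.
Proof.
rewrite /trunc_prod; elim: s k => [|j s IHs] k ltkn; first by rewrite big_nil coef1.
rewrite big_cons coefM /= /conv; apply: eq_bigr => i _.
have lein : (i < n)%N by apply: leq_ltn_trans ltkn; rewrite -ltnS.
by rewrite coef_poly lein IHs // (leq_ltn_trans (leq_subr _ _) ltkn).
Qed.

End Series.

(** Commutativity is inherited from the polynomial product of the truncations; it lets the root 1 be
    moved to the front of the enumeration. *)
Lemma conv_prod_perm (F : comNzRingType) (I : eqType) (f : I -> nat -> F) (s t : seq I) :
  perm_eq s t -> conv_prod f s =1 conv_prod f t.
Proof.
move=> st k; rewrite -!(@coef_trunc_prod _ _ _ k.+1) //.
by rewrite /trunc_prod (perm_big t).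
Qed.

(** Distributing the product over the truncated sums picks one exponent per factor, and the
    coefficient of [X^n] keeps the choices of total degree n. Exponents above n cannot occur in
    them, so the truncation loses nothing. *)
Lemma conv_prod_ffun (F : comNzRingType) (I : finType) (f : I -> nat -> F) (n : nat) :
  conv_prod f (index_enum I) n =
  \sum_(m : {ffun I -> 'I_n.+1} | (\sum_j m j == n)%N) \prod_j f j (m j).
Proof.
rewrite -(@coef_trunc_prod _ _ _ n.+1) // /trunc_prod.
under eq_bigr => j _ do rewrite poly_def.
rewrite (bigA_distr_bigA (fun j (i : 'I_n.+1) => f j i *: 'X^i)) coef_sum.
rewrite [RHS]big_mkcond; apply: eq_bigr => m _ /=.
rewrite scaler_prod prodrXr coefZ coefXn.
by rewrite eq_sym; case: eqP => _; rewrite ?mulr1 ?mulr0.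
Qed.

Section LogDerivative.
Variables (F : fieldType) (I : eqType) (b al : I -> F).

Fixpoint rootp (s : seq I) : {poly F} :=
  if s is j :: s' then ('X - (b j)%:P) * rootp s' else 1.

(* [logdp s / rootp s] is the sum over [s] of [al j / (X - b j)]. *)
Fixpoint logdp (s : seq I) : {poly F} :=
  if s is j :: s' then al j *: rootp s' + ('X - (b j)%:P) * logdp s' else 0.

Lemma rootpE (s : seq I) : rootp s = \prod_(j <- s) ('X - (b j)%:P).
Proof. by elim: s => [|j s IHs] /=; rewrite ?big_nil // big_cons IHs. Qed.

Lemma root_rootp (s : seq I) (j : I) : j \in s -> (rootp s).[b j] = 0.
Proof.
elim: s => //= i s IHs; rewrite inE hornerM => /orP[/eqP <-|/IHs ->].
  by rewrite !hornerE subrr mul0r.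
by rewrite mulr0.
Qed.

Lemma size_rootp (s : seq I) : size (rootp s) = (size s).+1.
Proof. by rewrite rootpE size_prod_XsubC. Qed.

Lemma size_logdp (s : seq I) : (size (logdp s) <= size s)%N.
Proof.
elim: s => [|j s IHs] /=; first by rewrite size_poly0.
apply: leq_trans (size_polyD _ _) _; rewrite geq_max; apply/andP; split.
  by apply: leq_trans (size_scale_leq _ _) _; rewrite size_rootp.
apply: leq_trans (size_polyMleq _ _) _; rewrite size_XsubC /=.
by rewrite ltnS.
Qed.

Lemma horner_logdp (s : seq I) (j : I) :
  uniq s -> j \in s -> (logdp s).[b j] = al j * (rootp s)^`().[b j].
Proof.
elim: s => //= i s IHs /andP[nis us]; rewrite inE derivM derivXsubC mul1r.
rewrite !hornerD !hornerM hornerZ !hornerXsubC; case: eqVneq => [->|nji] /= js.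
  by rewrite subrr !mul0r !addr0.
by rewrite IHs // root_rootp // mulr0 !add0r mulrCA.
Qed.

Variable f : I -> nat -> F.
Hypothesis fS : forall j i, b j * (f j i.+1 *+ i.+1) = (i%:R - al j) * f j i.

Lemma dvdp_XnP (n : nat) (p : {poly F}) :
  reflect (forall k, (k < n)%N -> p`_k = 0) ('X^n %| p).
Proof.
apply: (iffP idP) => [/dvdpP[q ->] k ltkn|p0]; first by rewrite coefMXn ltkn.
rewrite -(poly_take_drop n p) dvdp_addr ?dvdp_mull //.
suff -> : take_poly n p = 0 by rewrite dvdp0.
by apply/polyP => k; rewrite coef_take_poly coef0; case: ltnP => // /p0.
Qed.

(** [fS] is the coefficient form of (X - b) F' = al F, the equation of (1 - X / b)^al. Coefficient k
    of the left side needs F up to k + 1 <= n, hence the truncation at n + 1. *)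
Lemma logderiv_factor (n : nat) (j : I) :
  'X^n %| ('X - (b j)%:P) * (\poly_(i < n.+1) f j i)^`() - al j *: \poly_(i < n.+1) f j i.
Proof.
apply/dvdp_XnP => k ltkn.
rewrite mulrBl !coefB coefXM coefCM coefZ !coef_deriv !coef_poly !ltnS ltkn (ltnW ltkn) fS.
case: k ltkn => [|k] ltkn /=; first by ring.
by rewrite (ltnW ltkn) -mulr_natl; ring.
Qed.

Lemma logderiv_trunc_prod (n : nat) (s : seq I) :
  'X^n %| rootp s * (trunc_prod f n.+1 s)^`() - logdp s * trunc_prod f n.+1 s.
Proof.
rewrite /trunc_prod; elim: s => [|j s IHs] /=.
  by rewrite big_nil derivC mulr0 mul0r subr0 dvdp0.
rewrite big_cons; set G := \poly_(i < _) _; set P := \prod_(_ <- _) _ in IHs *.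
(* By the product rule the new defect is a combination of the defect of the head factor and that of
   the tail. *)
have -> : ('X - (b j)%:P) * rootp s * (G * P)^`()
    - (al j *: rootp s + ('X - (b j)%:P) * logdp s) * (G * P)
  = rootp s * P * (('X - (b j)%:P) * G^`() - al j *: G)
    + ('X - (b j)%:P) * G * (rootp s * P^`() - logdp s * P).
  by rewrite derivM -!mul_polyC; ring.
by rewrite dvdp_addr ?dvdp_mull ?logderiv_factor.
Qed.

Lemma horner_logdp_sum (s : seq I) (x : F) :
  {in s, forall j, x != b j} ->
  (logdp s).[x] = (rootp s).[x] * \sum_(j <- s) al j / (x - b j).
Proof.
elim: s => [|j s IHs] /= xs; first by rewrite big_nil horner0 mulr0.
have xj : x - b j != 0 by rewrite subr_eq0 xs ?mem_head.
rewrite big_cons hornerD hornerZ !hornerM hornerXsubC IHs; last first.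
  by move=> i si; rewrite xs // inE si orbT.
by field.
Qed.

End LogDerivative.

Section Recurrence.
Variables (F : fieldType) (I : eqType) (b al : I -> F) (s : seq I).
Variables (W : {poly F}) (c q1 : F).
Hypothesis ub : uniq [seq b j | j <- s].
Hypothesis WE : W = c *: rootp b s.
Hypotheses (c0 : c != 0) (q10 : q1 != 0) (W0 : W.[0] = - q1).
Hypothesis alE : forall j, al j = - 1 - q1 / (W^`().[b j] * b j).

Lemma root_neq0 (j : I) : j \in s -> b j != 0.
Proof.
move=> js; apply: contraNneq q10 => bj0.
have := W0; rewrite -{1}bj0 WE hornerZ root_rootp // mulr0 => /eqP.
by rewrite eq_sym oppr_eq0.
Qed.

(** Distinct roots are simple: peeling off the head, either only the term without the head factor
    survives, or the head factor is nonzero and induction applies. *)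
Lemma deriv_root_neq0 (j : I) : j \in s -> W^`().[b j] != 0.
Proof.
rewrite WE derivZ hornerZ mulf_eq0 negb_or c0 /=.
elim: (s) (ub) => //= i s' IHs /andP[nis us]; rewrite inE derivM derivXsubC mul1r.
rewrite hornerD hornerM hornerXsubC; case: eqVneq => [->|nji] /= js.
  rewrite subrr mul0r addr0 rootpE -(big_map b predT (fun z => 'X - z%:P)).
  by rewrite -rootE root_prod_XsubC.
rewrite root_rootp // add0r mulf_neq0 ?IHs // subr_eq0.
by apply: contraNneq nis => <-; apply: map_f.
Qed.

Lemma logdp_identity :
  c *: ('X * logdp b al s) = - (q1%:P + W + 'X * W^`()).
Proof.
apply/eqP; rewrite -subr_eq0 opprK; apply/eqP.
have us : uniq s by apply: map_uniq ub.
apply: (@roots_geq_poly_eq0 _ _ (0 :: [seq b j | j <- s])).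
- apply/andP; split.
    by rewrite /root !(hornerD, hornerZ, hornerM, hornerX,
      hornerC) W0 !mul0r mulr0 subrr addr0 addr0.
  apply/allP => _ /mapP[j js ->].
  rewrite /root !(hornerD, hornerZ, hornerM, hornerX, hornerC) horner_logdp //.
  have -> : W.[b j] = 0 by rewrite WE hornerZ root_rootp ?mulr0.
  have dW : W^`().[b j] = c * (rootp b s)^`().[b j] by rewrite WE derivZ hornerZ.
  have := deriv_root_neq0 js; have := root_neq0 js; rewrite alE dW.
  move: (rootp _ _)^`().[_] => d bj0; rewrite mulf_eq0 => /norP[_ d0].
  (* W vanishes at b_j, so the difference is b_j W'(b_j) (al_j + 1) + q1, which the value of al_j
     makes zero. *)
  by apply/eqP; field; rewrite bj0 c0 d0.
- rewrite /= ub andbT; apply/negP => /mapP[j js bj0].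
  by have := root_neq0 js; rewrite -bj0 eqxx.
have sW : (size W <= (size s).+1)%N by rewrite WE (leq_trans (size_scale_leq _ _)) ?size_rootp.
rewrite /= size_map; apply: leq_trans (size_polyD _ _) _; rewrite geq_max; apply/andP; split.
  apply: leq_trans (size_scale_leq _ _) _; apply: leq_trans (size_polyMleq _ _) _.
  by rewrite size_polyX /= ltnS size_logdp.
apply: leq_trans (size_polyD _ _) _; rewrite geq_max; apply/andP; split.
  apply: leq_trans (size_polyD _ _) _; rewrite geq_max sW andbT.
  by rewrite size_polyC q10.
apply: leq_trans (size_polyMleq _ _) _; rewrite size_polyX /=.
have [->|nzW] := eqVneq W 0; first by rewrite derivC size_poly0.
by apply: leq_trans sW; apply: lt_size_deriv.
Qed.

(** By [logdp_identity] the product P satisfies (X W P)' = - q1 P up to the truncation order.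
    Coefficient k reads (k + 1) (W P)_k = - q1 P_k; adding (k + 1) q1 P_k to both sides turns W into
    W + q1 and leaves k q1 P_k. *)
Lemma conv_prod_recurrence (f : I -> nat -> F) (k : nat) :
  (forall j i, b j * (f j i.+1 *+ i.+1) = (i%:R - al j) * f j i) ->
  (q1 * conv_prod f s k) *+ k = conv (fun i => (W + q1%:P)`_i) (conv_prod f s) k *+ k.+1.
Proof.
move=> fS; pose P := trunc_prod f k.+1 s.
have Pk i : (i <= k)%N -> P`_i = conv_prod f s i by move=> ik; rewrite coef_trunc_prod.
have : 'X^(k.+1) %| ('X * (W * P))^`() + q1 *: P.
  have -> : ('X * (W * P))^`() + q1 *: P
     = c%:P * 'X * (rootp b s * P^`() - logdp b al s * P).
    transitivity ('X * (c *: rootp b s) * P^`() - (c *: ('X * logdp b al s)) * P).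
      by rewrite logdp_identity -WE !derivM derivX -mul_polyC; ring.
    by rewrite -!mul_polyC; ring.
  by rewrite exprS dvdp_mul ?dvdp_mull ?logderiv_trunc_prod.
move/dvdp_XnP/(_ k (leqnn _)); rewrite coefD coef_deriv coefXM coefZ /= Pk // => E.
have -> : conv (fun i => (W + q1%:P)`_i) (conv_prod f s) k = (W * P)`_k + q1 * conv_prod f s k.
  rewrite -Pk // -coefCM -coefD -mulrDl coefM; apply: eq_bigr => i _.
  by rewrite Pk // leq_subr.
by rewrite mulrnDl (mulrS (q1 * _)) addrA E add0r.
Qed.

End Recurrence.

(** Since Q_0 = 0, the convolution at k + 1 involves only earlier terms, and the factor k + 1 on the
    left is invertible. At k = 0 the relation reads 0 = 0, so the initial value has to be given. *)
Lemma recurrence_unique (F : fieldType) (Q u v : nat -> F) (q1 : F) :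
  (forall n, n.+1%:R != 0 :> F) -> q1 != 0 -> Q 0%N = 0 -> u 0%N = v 0%N ->
  (forall k, (q1 * u k) *+ k = conv Q u k *+ k.+1) ->
  (forall k, (q1 * v k) *+ k = conv Q v k *+ k.+1) -> u =1 v.
Proof.
move=> ch0 q10 Q0 uv0 ru rv k.
have [n] := ubnP k; elim: n k => // n IHn [|k] // /ltnSE lekn.
have /(mulIf (ch0 k)) : (q1 * u k.+1) * k.+1%:R = (q1 * v k.+1) * k.+1%:R.
  rewrite !mulr_natr ru rv; congr (_ *+ _); apply: eq_bigr => -[[|i] ltik] _ /=.
    by rewrite Q0 !mul0r.
  by rewrite IHn // subSS (leq_ltn_trans (leq_subr _ _)).
exact: mulfI.
Qed.

(** Differentiating the identity once at the simple root 1 frees [logdp b al s] from its factor X -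
    1. The derivative of [rootp b s] at 1 is then eliminated through W''(1) = 2 c (rootp b s)'(1),
    whence the factor 2. *)
Lemma logdp_at1 (F : fieldType) (I : eqType) (b al : I -> F) (j1 : I) (s : seq I)
    (W : {poly F}) (c q1 : F) :
  b j1 = 1 -> W = c *: rootp b (j1 :: s) ->
  c *: ('X * logdp b al (j1 :: s)) = - (q1%:P + W + 'X * W^`()) ->
  W^`().[1] = c * (rootp b s).[1] /\
  2%:R * c * (logdp b al s).[1] = - (2%:R * W^`().[1] + W^`()^`().[1]) * (2%:R + al j1).
Proof.
move=> b1 WE /(congr1 deriv)/(congr1 (horner^~ 1)).
rewrite WE /= b1 !(derivD, derivM, derivZ, derivN, derivX, derivC, derivXsubC).
rewrite !(hornerD, hornerN, hornerZ, hornerM, hornerX, hornerC) subrr => E.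
split; first by ring.
move: E; set L := (L in L = _); set M := (M in _ = M) => E.
apply/eqP; rewrite -subr_eq0; apply/eqP; transitivity (2%:R * (L - M)).
  by rewrite /L /M; ring.
by rewrite E subrr mulr0.
Qed.

End FormalProduct.

(** * Complex numbers as a MathComp field *)

(** The field interface prescribes 0 as the inverse of 0. *)
Lemma Cinv_0 : (/ 0)%C = 0%C.
Proof. by rewrite /Cinv /= /Rdiv; apply: injective_projections => /=; ring. Qed.

HB.instance Definition _ := gen_eqMixin C.
HB.instance Definition _ := gen_choiceMixin C.
HB.instance Definition _ :=
  GRing.isZmodule.Build C Cplus_assoc Cplus_comm Cplus_0_l
    (fun z => etrans (Cplus_comm _ _) (Cplus_opp_r z)).

Lemma C_mulDl : left_distributive Cmult Cplus.
Proof. by move=> x y z; rewrite Cmult_plus_distr_r. Qed.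

Lemma C_1_neq_0 : RtoC 1 != RtoC 0.
Proof. by apply/eqP => /RtoC_inj; lra. Qed.

HB.instance Definition _ :=
  GRing.Zmodule_isComNzRing.Build C Cmult_assoc Cmult_comm Cmult_1_l C_mulDl C_1_neq_0.

Lemma C_mulVf (z : C) : z != RtoC 0 -> (/ z * z)%C = RtoC 1.
Proof. by move=> /eqP z0; rewrite Cmult_comm Cinv_r. Qed.

HB.instance Definition _ := GRing.ComNzRing_isField.Build C C_mulVf Cinv_0.

HB.instance Definition _ :=
  Monoid.isComLaw.Build C (RtoC 1) Cmult Cmult_assoc Cmult_comm Cmult_1_l.

Section CField.
Import GRing.Theory.

Lemma C_natrE (n : nat) : (n%:R)%R = RtoC (INR n) :> C.
Proof.
elim: n => [|n IHn]; first by rewrite mulr0n.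
by rewrite S_INR RtoC_plus -IHn mulrSr.
Qed.

Lemma C_mulrnE (z : C) (n : nat) : (z *+ n)%R = (z * INR n)%C.
Proof. by rewrite -C_natrE -(mulr_natr z). Qed.

Lemma C_expE (z : C) (n : nat) : (z ^+ n)%R = (z ^ n)%C.
Proof. by elim: n => // n IHn; rewrite exprS IHn. Qed.

Lemma C_natS_neq0 (n : nat) : (n.+1%:R != 0 :> C)%R.
Proof. by rewrite C_natrE; apply/eqP => /RtoC_inj; apply: not_0_INR. Qed.

Lemma CbinomS (al : C) (n : nat) :
  (Cbinom al n.+1 * INR n.+1)%C = ((al - INR n) * Cbinom al n)%C.
Proof.
have E : \big[Cmult/RtoC 1]_(k < n.+1) (al - INR k)%C
    = (\big[Cmult/RtoC 1]_(k < n) (al - INR k) * (al - INR n))%C by rewrite big_ord_recr.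
rewrite /Cbinom E factS mult_INR RtoC_mult.
have n0 : RtoC (INR n.+1) <> 0 by move=> /RtoC_inj; apply: not_0_INR.
have f0 : RtoC (INR n`!) <> 0.
  by move=> /RtoC_inj; apply: not_0_INR => f0; have := fact_gt0 n; rewrite f0.
by field.
Qed.

(* Coefficients of [(1 - z / b) ^ al]. *)
Definition binom_coef (al b : C) (n : nat) : C := (Cbinom al n * (- 1 / b) ^ n)%C.

Lemma binom_coef0 (al b : C) : binom_coef al b 0 = 1.
Proof.
by rewrite /binom_coef /Cbinom big_ord0 /= /Cdiv; field; move=> /RtoC_inj; lra.
Qed.

Lemma binom_coefS (al b : C) (n : nat) : b <> 0 ->
  (b * (binom_coef al b n.+1 * INR n.+1))%C = ((INR n - al) * binom_coef al b n)%C.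
Proof.
move=> b0; rewrite /binom_coef [(_ ^ n.+1)%C]/=.
transitivity (b * (- 1 / b * (- 1 / b) ^ n) * (Cbinom al n.+1 * INR n.+1))%C; first by ring.
by rewrite CbinomS; field.
Qed.

End CField.

(** * The Gamma function *)

Section GammaFunction.

Definition gamma_fun (x t : R) : R := Rpower t (x - 1) * exp (- t).

Definition is_Gamma (x l : R) : Prop :=
  is_RInt_gen (gamma_fun x) (at_right 0) (Rbar_locally p_infty) l.

Lemma is_Gamma_unique (x l : R) : is_Gamma x l -> Gamma x = l.
Proof. by move=> xl; refine (@is_RInt_gen_unique R_CompleteNormedModule _ _ _ _ _ _ xl). Qed.

Lemma filter_prod_0_infty (P : R -> R -> Prop) (a0 T0 : R) :
  0 < a0 -> (forall a T, 0 < a < a0 -> T0 < T -> P a T) ->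
  filter_prod (at_right 0) (Rbar_locally p_infty) (fun ab => P ab.1 ab.2).
Proof.
move=> a0_gt0 PaT; exists (fun a => 0 < a < a0) (fun T => T0 < T).
- exists (mkposreal _ a0_gt0) => y; rewrite /ball /= /AbsRing_ball /abs /minus /plus /opp /=.
  by move=> /Rabs_def2 [? ?] ?; lra.
- by exists T0.
by move=> a T /=; apply: PaT.
Qed.

(** For f >= 0 the integrals grow with the interval, so their supremum is the limit at both ends
    simultaneously. *)
Lemma ex_RInt_gen_pos_bounded (f : R -> R) (M : R) :
  (forall t, 0 < t -> 0 <= f t) -> (forall t, 0 < t -> continuous f t) ->
  (forall a T, 0 < a <= T -> RInt f a T <= M) ->
  ex_RInt_gen f (at_right 0) (Rbar_locally p_infty).
Proof.
move=> f_ge0 f_cont f_le.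
have f_int a T : 0 < a -> 0 < T -> ex_RInt f a T.
  move=> a0 T0; apply: (@ex_RInt_continuous R_CompleteNormedModule) => t [t1 _]; apply: f_cont.
  by apply: Rlt_le_trans t1; apply: Rmin_pos.
pose E l := exists a T, 0 < a <= T /\ l = RInt f a T.
have [l [l_ub l_lub]] : { l | is_lub E l }.
  apply: completeness; first by exists M => _ [a [T [aT ->]]]; apply: f_le.
  by exists (RInt f 1 1), 1, 1; split=> //; lra.
have Rmono a0 T0 a T : 0 < a < a0 -> a0 <= T0 -> T0 < T -> RInt f a0 T0 <= RInt f a T.
  move=> Ha Ha0 HT.
  have i1 : ex_RInt f a a0 by apply: f_int; lra.
  have i2 : ex_RInt f a0 T0 by apply: f_int; lra.
  have i3 : ex_RInt f T0 T by apply: f_int; lra.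
  have i4 : ex_RInt f a T0 by apply: f_int; lra.
  have <- := RInt_Chasles f a T0 T i4 i3; have <- := RInt_Chasles f a a0 T0 i1 i2.
  have : 0 <= RInt f a a0 by apply: RInt_ge_0 => //; [lra|move=> t ?; apply: f_ge0; lra].
  have : 0 <= RInt f T0 T by apply: RInt_ge_0 => //; [lra|move=> t ?; apply: f_ge0; lra].
  by rewrite /plus /=; lra.
exists l; apply/filterlimi_locally => eps.
have [a0 [T0 [aT0 Hl]]] : exists a T, 0 < a <= T /\ l - eps < RInt f a T.
  apply: contrapT => no; have := cond_pos eps.
  suff : l <= l - eps by lra.
  apply: l_lub => _ [a [T [aT ->]]]; apply: Rnot_lt_le => lt; apply: no.
  by exists a, T.
apply: (@filter_prod_0_infty (fun a T => exists y, is_RInt f a T y /\ ball l eps y) a0 T0).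
  by case: aT0.
move=> a T Ha HT; exists (RInt f a T); split.
  by apply: (@RInt_correct R_CompleteNormedModule); apply: f_int; lra.
have := @Rmono a0 T0 a T Ha (proj2 aT0) HT.
have : RInt f a T <= l by apply: l_ub; exists a, T; split=> //; lra.
move=> ? ?; rewrite /ball /= /AbsRing_ball /abs /minus /plus /opp /=.
by apply: Rabs_def1; have := cond_pos eps; lra.
Qed.

Lemma gamma_fun_pos (x t : R) : 0 < gamma_fun x t.
Proof. by apply: Rmult_lt_0_compat; apply: exp_pos. Qed.

Lemma continuous_gamma_fun (x t : R) : 0 < t -> continuous (gamma_fun x) t.
Proof.
move=> t0; apply: ex_derive_continuous.
by rewrite /gamma_fun /Rpower; auto_derive.
Qed.

Lemma ln_le_sub1 (y : R) : 0 < y -> ln y <= y - 1.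
Proof. by move=> y0; have := exp_ineq1_le (ln y); rewrite exp_ln //; lra. Qed.

(** Weighted arithmetic-geometric mean of u and 1, whose arithmetic mean is v: apply [ln y <= y - 1]
    to u / v and 1 / v, whose weighted mean is 1. *)
Lemma Rpower_concave (u th : R) : 0 < u -> 0 <= th <= 1 -> Rpower u th <= 1 + th * (u - 1).
Proof.
move=> u0 th01; set v := 1 + th * (u - 1).
have v0 : 0 < v by rewrite /v; nra.
rewrite -(exp_ln v v0) /Rpower.
suff : th * ln u <= ln v by case=> [/exp_increasing|->]; lra.
have vi : 0 < / v by apply: Rinv_0_lt_compat.
have /ln_le_sub1 : 0 < u / v by apply: Rdiv_lt_0_compat.
have /ln_le_sub1 := vi.
rewrite ln_div // ln_Rinv // => h1 h2.
have : th * (ln u - ln v) + (1 - th) * (- ln v) <= th * (u / v - 1) + (1 - th) * (/ v - 1) by nra.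
have vE : th * u + (1 - th) = v by rewrite /v; ring.
have -> : th * (u / v - 1) + (1 - th) * (/ v - 1) = (th * u + (1 - th)) / v - 1 by field; lra.
by rewrite vE /Rdiv Rinv_r; lra.
Qed.

Lemma is_lim_mul_ln_sub (x : R) : is_lim (fun t => x * ln t - t) p_infty m_infty.
Proof.
apply: (is_lim_ext_loc (fun t => t * (x * (ln t / t) - 1))).
  by exists 0 => t t0; field; lra.
have neg : is_Rbar_mult p_infty (-1) m_infty by apply: is_Rbar_mult_p_infty_neg => /=; lra.
rewrite -(is_Rbar_mult_unique _ _ _ neg); apply: is_lim_mult; first exact: is_lim_id; last first.
  by rewrite /ex_Rbar_mult; lra.
have -> : (-1) = x * 0 - 1 by ring.
apply: is_lim_minus'; last exact: is_lim_const.
exact: (is_lim_scal_l _ x _ _ is_lim_div_ln_p).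
Qed.

(** As x - 1 lies in [0, 1], concavity gives t^(x - 1) <= 1 + t, and (1 + t) exp(-t) has integral 2
    over the half-line, hence the bound 2. This range of x is that of 1 + s. *)
Lemma ex_Gamma (x : R) : 1 <= x <= 2 -> exists l, is_Gamma x l.
Proof.
move=> x12; apply: (@ex_RInt_gen_pos_bounded _ 2).
- by move=> t _; have := gamma_fun_pos x t; lra.
- by move=> t; apply: continuous_gamma_fun.
move=> a T aT; pose h t := (1 + t) * exp (- t).
have ih : is_RInt h a T (- (2 + T) * exp (- T) - - (2 + a) * exp (- a)).
  apply: (@is_RInt_derive R_CompleteNormedModule (fun t => - (2 + t) * exp (- t))) => t _.
    by rewrite /h; auto_derive => //; ring.
  by apply: ex_derive_continuous; rewrite /h; auto_derive.
apply: (@Rle_trans _ (RInt h a T)).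
  apply: RInt_le; first lra.
  - apply: (@ex_RInt_continuous R_CompleteNormedModule) => t [t1 _].
    by apply: continuous_gamma_fun; rewrite Rmin_left in t1; lra.
  - by eexists; apply: ih.
  move=> t t1; apply: Rmult_le_compat_r; first exact: Rlt_le (exp_pos _).
  have : Rpower t (x - 1) <= 1 + (x - 1) * (t - 1) by apply: Rpower_concave; lra.
  by nra.
rewrite (is_RInt_unique _ _ _ _ ih).
have := exp_pos (- T); have := exp_ineq1_le a.
have : exp (- a) * exp a = 1 by rewrite -exp_plus Rplus_opp_l exp_0.
have := exp_pos (- a); have := exp_pos a; nra.
Qed.

Lemma is_RInt_gen_0_infty_derive (f df : R -> R) (la lb : R) :
  (forall t, 0 < t -> is_derive f t (df t)) -> (forall t, 0 < t -> continuous df t) ->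
  filterlim f (at_right 0) (locally la) -> filterlim f (Rbar_locally p_infty) (locally lb) ->
  is_RInt_gen df (at_right 0) (Rbar_locally p_infty) (lb - la).
Proof.
move=> fd dfc fa fb.
have Df t : 0 < t -> Derive f t = df t by move=> /fd; apply: is_derive_unique.
have near_pos (P : R -> Prop) : (forall t, 0 < t -> P t) -> forall a T, 0 < a < 1 -> 1 < T ->
    forall t, Rmin a T <= t <= Rmax a T -> P t.
  by move=> Pt a T Ha HT t; rewrite Rmin_left; [move=> ?; apply: Pt; lra|lra].
apply: (is_RInt_gen_ext (Derive f)).
  apply: (@filter_prod_0_infty (fun a T => forall t, Rmin a T < t < Rmax a T ->
    Derive f t = df t) 1 1); first lra.
  by move=> a T Ha HT t Ht; apply: (near_pos _ Df a T) => //; lra.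
apply: is_RInt_gen_Derive => //.
  apply: (@filter_prod_0_infty (fun a T => forall t, Rmin a T <= t <= Rmax a T ->
    ex_derive f t) 1 1); first lra.
  by apply: near_pos => t /fd ?; eexists; eassumption.
apply: (@filter_prod_0_infty (fun a T => forall t, Rmin a T <= t <= Rmax a T ->
  continuous (Derive f) t) 1 1); first lra.
apply: near_pos => t t0; apply: continuous_ext_loc (dfc t t0).
by exists (mkposreal _ t0) => y; rewrite /ball /= /AbsRing_ball /abs /minus /plus /opp /= =>
  /Rabs_def2 [? ?]; symmetry; apply: Df; lra.
Qed.

Lemma is_Gamma_1 : is_Gamma 1 1.
Proof.
rewrite /is_Gamma; have {2}-> : 1 = 0 - - 1 by ring.
apply: (is_RInt_gen_ext (fun t => exp (- t))).
  apply: (@filter_prod_0_infty (fun a T => forall t, Rmin a T < t < Rmax a T ->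
    exp (- t) = gamma_fun 1 t) 1 1); first lra.
  move=> a T Ha HT t; rewrite Rmin_left => [[? ?]|]; last lra.
  by rewrite /gamma_fun Rminus_diag Rpower_O ?Rmult_1_l; lra.
apply: (@is_RInt_gen_0_infty_derive (fun t => - exp (- t))) => [t _|t _||].
- by auto_derive => //; ring.
- by apply: ex_derive_continuous; auto_derive.
- apply: (filterlim_filter_le_1 _ (@filter_le_within _ (locally 0) _ (fun t => 0 < t))).
  have -> : -1 = - exp (- 0) by rewrite Ropp_0 exp_0.
  by apply: ex_derive_continuous; auto_derive.
rewrite -Ropp_0; apply: (is_lim_opp (fun t => exp (- t)) p_infty 0).
apply: (is_lim_comp exp Ropp p_infty 0 m_infty); first exact: is_lim_exp_m.
  by apply: (is_lim_opp id p_infty p_infty); apply: is_lim_id.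
by exists 0.
Qed.

(** Integration by parts: - t^x exp(-t) is a primitive of the difference of the two integrands and
    tends to 0 at both ends. *)
Lemma is_Gamma_succ (x l : R) : 1 <= x -> is_Gamma x l -> is_Gamma (x + 1) (x * l).
Proof.
move=> x1 xl; pose h t := Rpower t x * exp (- t).
have ih : is_RInt_gen (fun t => gamma_fun (x + 1) t - x * gamma_fun x t)
    (at_right 0) (Rbar_locally p_infty) (0 - 0).
  apply: (@is_RInt_gen_0_infty_derive (fun t => - h t)) => [t t0|t t0||].
  - rewrite /h /gamma_fun /Rpower; auto_derive => //.
    rewrite (_ : (x + 1 - 1) * ln t = x * ln t); last ring.
    rewrite (_ : (x - 1) * ln t = x * ln t + - ln t); last ring.
    by rewrite exp_plus (exp_Ropp (ln t)) exp_ln //; field; lra.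
  - by apply: ex_derive_continuous; rewrite /gamma_fun /Rpower; auto_derive.
  - have {2}-> : 0 = - (0 * exp (- 0)) by ring.
    apply: (filterlim_comp _ _ _ h Ropp); last exact: (filterlim_opp (_ : R_NormedModule)).
    apply: (filterlim_comp_2 (G := locally 0) (H := locally (exp (- 0))));
      last exact: (filterlim_mult (K := R_AbsRing)).
      apply: (filterlim_comp _ _ _ (fun t => x * ln t) exp _ (Rbar_locally m_infty));
        last exact: is_lim_exp_m.
      apply: (filterlim_comp _ _ _ ln (Rmult x) _ (Rbar_locally m_infty)); first exact is_lim_ln_0.
      have neg : is_Rbar_mult x m_infty m_infty.
        by apply: is_Rbar_mult_sym; apply: is_Rbar_mult_m_infty_pos => /=; lra.
      rewrite -{2}(is_Rbar_mult_unique _ _ _ neg); exact: filterlim_Rbar_mult_l.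
    apply: (filterlim_filter_le_1 _ (@filter_le_within _ (locally 0) _ (fun t => 0 < t))).
    have : continuous (fun t => exp (- t)) 0 by apply: ex_derive_continuous; auto_derive.
    by [].
  rewrite -Ropp_0; apply: (is_lim_opp h p_infty 0).
  apply: (is_lim_ext (fun t => exp (x * ln t - t))).
    by move=> t; rewrite /h /Rpower -exp_plus.
  apply: (is_lim_comp exp _ p_infty 0 m_infty); first exact: is_lim_exp_m.
    exact: is_lim_mul_ln_sub.
  by exists 0.
rewrite /is_Gamma (_ : x * l = plus (0 - 0) (scal x l)); last by rewrite /plus /scal /= /mult /=;
  ring.
apply: (is_RInt_gen_ext (fun t =>
  plus (gamma_fun (x + 1) t - x * gamma_fun x t) (scal x (gamma_fun x t)))).
  by apply: filter_forall => ab t _; rewrite /plus /scal /= /mult /=; ring.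
apply: is_RInt_gen_plus => //.
exact: is_RInt_gen_scal.
Qed.

(* Integrate [t^th <= x^th (1 + th (t / x - 1))] against the density of [Gamma x]. *)
Lemma Gamma_shift_le (x th l l' : R) :
  1 <= x -> 0 <= th <= 1 -> is_Gamma x l -> is_Gamma (x + th) l' -> l' <= Rpower x th * l.
Proof.
move=> x1 th01 xl xl'; apply: Rle_trans (Rle_abs _) _.
have -> : Rpower x th * l
    = scal (Rpower x th) (plus (scal (1 - th) l) (scal (th / x) (x * l))).
  by rewrite /plus /scal /= /mult /=; field; lra.
have pf1 : ProperFilter (at_right 0) by apply: at_right_proper_filter.
have pf2 : ProperFilter (Rbar_locally p_infty) by apply: Rbar_locally_filter.
refine (@RInt_gen_norm R_CompleteNormedModule _ _ pf1 pf2 (gamma_fun (x + th))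
  (fun t => scal (Rpower x th) (plus (scal (1 - th) (gamma_fun x t))
     (scal (th / x) (gamma_fun (x + 1) t)))) _ _ _ _ xl' _).
- by apply: (@filter_prod_0_infty (fun a T => a <= T) 1 1) => [|a T ? ?]; lra.
- apply: (@filter_prod_0_infty (fun a T => forall t, a <= t <= T -> _ <= _) 1 1) => [|a T ? ? t aT].
    by lra.
  have t0 : 0 < t by lra.
  rewrite /norm /= /abs /= Rabs_pos_eq; last exact: Rlt_le (gamma_fun_pos _ _).
  rewrite /plus /scal /= /mult /= /gamma_fun.
  have -> : Rpower t (x + th - 1) = Rpower x th * Rpower t (x - 1) * Rpower (t / x) th.
    have -> : x + th - 1 = (x - 1) + th by ring.
    rewrite Rpower_plus (_ : Rpower t th = Rpower x th * Rpower (t / x) th); first by ring.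
    by rewrite Rpower_mult_distr; [congr Rpower; field; lra|lra|apply: Rdiv_lt_0_compat; lra].
  have -> : Rpower t (x + 1 - 1) = t * Rpower t (x - 1).
    have -> : x + 1 - 1 = (x - 1) + 1 by ring.
    by rewrite Rpower_plus Rpower_1 //; ring.
  have tx : 0 < t / x by apply: Rdiv_lt_0_compat; lra.
  have := Rpower_concave tx th01.
  have p1 : 0 < Rpower x th * Rpower t (x - 1) * exp (- t).
    by repeat apply: Rmult_lt_0_compat; apply: exp_pos.
  move/(Rmult_le_compat_l _ _ _ (Rlt_le _ _ p1)) => le1.
  by apply: Rle_trans (Rle_trans _ _ _ _ le1) _; apply: Req_le; field; lra.
apply: is_RInt_gen_scal; apply: is_RInt_gen_plus; apply: is_RInt_gen_scal => //.
exact: is_Gamma_succ.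
Qed.

(* [rising s k = (s + 1) ... (s + k) / k!] *)
Fixpoint rising (s : R) (k : nat) : R :=
  if k is k'.+1 then rising s k' * (1 + s / INR k) else 1.

Lemma risingS (s : R) (k : nat) : rising s k.+1 = rising s k * (1 + s / INR k.+1).
Proof. by []. Qed.

Lemma rising_pos (s : R) (k : nat) : 0 < s -> 0 < rising s k.
Proof.
move=> s0; elim: k => [|k IHk]; first by rewrite /=; lra.
rewrite risingS; apply: Rmult_lt_0_compat => //.
by have : 0 < s / INR k.+1; [apply: Rdiv_lt_0_compat => //; apply: lt_0_INR;
  apply: Nat.lt_0_succ|lra].
Qed.

Lemma INR_S_ge1 (k : nat) : 1 <= INR k.+1.
Proof. by have := le_INR 1 k.+1 (le_n_S _ _ (Nat.le_0_l k)); rewrite [INR 1]/=. Qed.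

Lemma is_Gamma_rising (s l : R) (k : nat) : 0 <= s -> is_Gamma (1 + s) l ->
  is_Gamma (INR k.+1 + s) (l * INR (Factorial.fact k) * rising s k).
Proof.
move=> s0 sl; elim: k => [|k IHk].
  by rewrite /= !Rmult_1_r.
have -> : INR k.+2 + s = INR k.+1 + s + 1 by rewrite (S_INR k.+1); ring.
have -> : l * INR (Factorial.fact k.+1) * rising s k.+1
    = (INR k.+1 + s) * (l * INR (Factorial.fact k) * rising s k).
  rewrite fact_simpl mult_INR risingS.
  by field; apply: not_0_INR.
apply: is_Gamma_succ IHk.
by have := INR_S_ge1 k; lra.
Qed.

Lemma is_Gamma_fact (k : nat) : is_Gamma (INR k.+1) (INR (Factorial.fact k)).
Proof.
elim: k => [|k IHk]; first exact: is_Gamma_1.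
rewrite S_INR fact_simpl mult_INR; apply: is_Gamma_succ => //.
by have := INR_S_ge1 k; lra.
Qed.

Section RisingAsymptotics.
Variables (s l : R).
Hypotheses (s01 : 0 < s <= 1) (sl : is_Gamma (1 + s) l).

(** Convexity from k + 1 with shift s, divided by k!. *)
Lemma rising_upper (k : nat) : l * rising s k <= Rpower (INR k.+1) s.
Proof.
have s01' : 0 <= s <= 1 by lra.
have := Gamma_shift_le (INR_S_ge1 k) s01' (@is_Gamma_fact k) (@is_Gamma_rising s l k (proj1 s01') sl).
have := INR_fact_lt_0 k => f0 le1; apply: (Rmult_le_reg_r _ _ _ f0); lra.
Qed.

(** The complementary shift 1 - s leads from k + 1 + s to k + 2, where Gamma is (k + 1)!. Together
    with [rising_upper] these are Wendel's inequalities. *)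
Lemma rising_lower (k : nat) : INR k.+1 <= Rpower (INR k.+1 + s) (1 - s) * (l * rising s k).
Proof.
have s01' : 0 <= 1 - s <= 1 by lra.
have x1 : 1 <= INR k.+1 + s by have := INR_S_ge1 k; lra.
have := @is_Gamma_fact k.+1; rewrite S_INR (_ : INR k.+1 + 1 = INR k.+1 + s + (1 - s)); last ring.
have s0 : 0 <= s by lra.
move/(Gamma_shift_le x1 s01' (@is_Gamma_rising s l k s0 sl)).
rewrite fact_simpl mult_INR.
have := INR_fact_lt_0 k => f0 le1; apply: (Rmult_le_reg_r _ _ _ f0); lra.
Qed.

(** The lower bound at k = 0 reads 1 <= (1 + s)^(1 - s) l. *)
Lemma Gamma_gt0 : 0 < l.
Proof.
have := rising_lower 0; rewrite /= Rmult_1_r => le1.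
by apply: (Rmult_lt_reg_l (Rpower (1 + s) (1 - s))); [apply: exp_pos|lra].
Qed.

End RisingAsymptotics.

End GammaFunction.

(** * Second-order asymptotics of (s + 1) ... (s + k) / k! *)

Section RisingLimit.

Lemma ln_shift_bounds (a x : R) : 0 < x -> 0 < x + a -> a / (x + a) <= ln (x + a) - ln x <= a / x.
Proof.
move=> x0 xa0; rewrite -ln_div //; split.
  have -> : ln ((x + a) / x) = - ln (x / (x + a)) by rewrite !ln_div //; ring.
  have /ln_le_sub1 : 0 < x / (x + a) by apply: Rdiv_lt_0_compat.
  have -> : a / (x + a) = - (x / (x + a) - 1) by field; lra.
  by lra.
have /ln_le_sub1 : 0 < (x + a) / x by apply: Rdiv_lt_0_compat.
by have -> : a / x = (x + a) / x - 1 by field; lra.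
Qed.

(* Logarithm of the ratio of consecutive terms of [rising s k / (k + 1 + a) ^ s],
   with [x = 1 / (k + 1)]. *)
Definition log_ratio (s a x : R) : R :=
  ln (1 + s * x) + s * (ln (1 + a * x) - ln (1 + (1 + a) * x)).

(** The derivative at c is s c (1 + 2 a - s + a (1 + a) c) divided by three positive factors. Its
    bracket gives the sign of the increments of [log_rising]; the constant term vanishes exactly at
    a = (s - 1) / 2. *)
Lemma log_ratio_MVT (s a x : R) : 0 < s -> -1 < a -> 0 < x <= 1 ->
  exists c K, 0 <= c <= x /\ 0 <= K /\ log_ratio s a x = K * (1 + 2 * a - s + a * (1 + a) * c).
Proof.
move=> s0 a1 x01.
pose dh c := s / (1 + s * c) + s * (a / (1 + a * c) - (1 + a) / (1 + (1 + a) * c)).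
have pos c : 0 <= c <= x -> 0 < 1 + s * c /\ 0 < 1 + a * c /\ 0 < 1 + (1 + a) * c.
  move=> cx; have sc : 0 <= s * c by apply: Rmult_le_pos; lra.
  have ac : 0 <= (1 + a) * c by apply: Rmult_le_pos; lra.
  by split; [lra|split; [case: (Req_dec c 1) => [->|?]; lra|lra]].
have [||c [cx E]] := MVT_gen (log_ratio s a) 0 x dh.
- move=> c; rewrite Rmin_left ?Rmax_right; try lra; move=> cx.
  have cx' : 0 <= c <= x by lra.
  have [p1 [p2 p3]] := pos c cx'.
  by rewrite /log_ratio /dh; auto_derive; [lra|field; lra].
- move=> c; rewrite Rmin_left ?Rmax_right; try lra; move=> cx.
  have [p1 [p2 p3]] := pos c cx.
  apply/continuity_pt_filterlim; apply: ex_derive_continuous.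
  by rewrite /log_ratio; auto_derive; lra.
rewrite Rmin_left ?Rmax_right in cx; try lra.
have [p1 [p2 p3]] := pos c cx.
exists c, (s * c * x / ((1 + s * c) * (1 + a * c) * (1 + (1 + a) * c))); split=> //; split.
  apply: Rmult_le_pos; first by apply: Rmult_le_pos; [apply: Rmult_le_pos|]; lra.
  by apply: Rlt_le; apply: Rinv_0_lt_compat; repeat apply: Rmult_lt_0_compat.
move: E; rewrite {2}/log_ratio !Rmult_0_r !Rplus_0_r ln_1 Rminus_diag Rmult_0_r Rplus_0_r
  Rminus_0_r => ->.
by rewrite Rminus_0_r /dh; field; lra.
Qed.

Variables (s l : R).
Hypotheses (s01 : 0 < s <= 1) (sl : is_Gamma (1 + s) l).

Let s_gt0 : 0 < s. Proof. by case: s01. Qed.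
Let l_gt0 : 0 < l. Proof. exact: Gamma_gt0 s01 sl. Qed.

Definition log_rising (a : R) (k : nat) : R := ln (l * rising s k) - s * ln (INR k.+1 + a).

Lemma log_risingS (a : R) (k : nat) : -1 < a ->
  log_rising a k.+1 = log_rising a k + log_ratio s a (/ INR k.+1).
Proof.
move=> a1; have n1 := INR_S_ge1 k; have rk := rising_pos k s_gt0.
have i0 : 0 < / INR k.+1 by apply: Rinv_0_lt_compat; lra.
have si : 0 < s * / INR k.+1 by apply: Rmult_lt_0_compat.
rewrite /log_rising risingS !ln_mult //; try by repeat apply: Rmult_lt_0_compat; rewrite /Rdiv; lra.
rewrite /log_ratio (S_INR k.+1).
have -> : 1 + a * / INR k.+1 = (INR k.+1 + a) / INR k.+1 by field; lra.
have -> : 1 + (1 + a) * / INR k.+1 = (INR k.+1 + 1 + a) / INR k.+1 by field; lra.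
by rewrite !ln_div; try lra; rewrite /Rdiv; ring.
Qed.

(** For a = 0 the two bounds on [rising] squeeze the sequence between - (1 - s) s / (k + 1) and 0;
    another a changes it by s (ln (k + 1 + a) - ln (k + 1)), which tends to 0. *)
Lemma log_rising_lim (a : R) : -1 < a -> is_lim_seq (log_rising a) 0.
Proof.
move=> a1.
have inv0 (c d : R) : is_lim_seq (fun k => c / (INR k.+1 + d)) 0.
  have -> : Rbar.Finite 0 = Rbar_mult c 0 by rewrite /= Rmult_0_r.
  apply: is_lim_seq_scal_l; apply: (is_lim_seq_inv _ p_infty) => //.
  apply: (is_lim_seq_plus _ _ p_infty d) => //; last exact: is_lim_seq_const.
  exact: (proj1 (is_lim_seq_incr_1 INR p_infty) is_lim_seq_INR).
have lb k : - (1 - s) * (s / (INR k.+1 + 0)) <= log_rising 0 k <= 0.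
  have n1 := INR_S_ge1 k; rewrite /log_rising !Rplus_0_r.
  have rk := rising_pos k s_gt0; have lr : 0 < l * rising s k by apply: Rmult_lt_0_compat.
  split; last first.
    have := rising_upper s01 sl k => /(ln_le _ _ lr); rewrite /Rpower ln_exp; lra.
  have nk : 0 < INR k.+1 by lra.
  have := rising_lower s01 sl k => /(ln_le _ _ nk); rewrite ln_mult //; last exact: exp_pos.
  rewrite /Rpower ln_exp.
  have nks : 0 < INR k.+1 + s by lra.
  by have := ln_shift_bounds nk nks; nra.
have l0 : is_lim_seq (log_rising 0) 0.
  apply: is_lim_seq_le_le lb _ (is_lim_seq_const 0).
  have {2}-> : 0 = - (1 - s) * 0 by ring.
  exact: (is_lim_seq_scal_l _ (- (1 - s)) 0 (inv0 s 0)).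
apply: (is_lim_seq_ext (fun k => log_rising 0 k - s * (ln (INR k.+1 + a) - ln (INR k.+1)))).
  by move=> k; rewrite /log_rising Rplus_0_r; ring.
have {2}-> : 0 = 0 - s * 0 by ring.
apply: is_lim_seq_minus' => //; apply: (is_lim_seq_scal_l _ s 0).
apply: (is_lim_seq_le_le (fun k => a / (INR k.+1 + a)) _ (fun k => a / (INR k.+1 + 0))) => // k.
by rewrite Rplus_0_r; apply: ln_shift_bounds; have := INR_S_ge1 k; lra.
Qed.

(* [log_rising a] tends to 0; it decreases for [a = (s - 1) / 2] and eventually increases for
   larger [a]. *)
Lemma log_rising_lower (k : nat) : 0 <= log_rising ((s - 1) / 2) k.
Proof.
have a1 : -1 < (s - 1) / 2 by lra.
apply: (is_lim_seq_decr_compare _ _ (log_rising_lim a1)) => {}k.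
rewrite log_risingS //.
have x01 : 0 < / INR k.+1 <= 1.
  have := INR_S_ge1 k => n1; split; first by apply: Rinv_0_lt_compat; lra.
  by rewrite -Rinv_1; apply: Rinv_le_contravar; lra.
have [c [K [cx [K0 ->]]]] := log_ratio_MVT s_gt0 a1 x01.
(* Only a (1 + a) c = - (1 - s) (1 + s) c / 4 remains in the bracket, so the sequence decreases to
   its limit 0. *)
suff : 0 <= K * (- (1 + 2 * ((s - 1) / 2) - s + (s - 1) / 2 * (1 + (s - 1) / 2) * c)) by lra.
have : 0 <= (1 - s) * (1 + s) * c by repeat apply: Rmult_le_pos; lra.
by move=> ?; apply: Rmult_le_pos => //; lra.
Qed.

Lemma log_rising_upper (a : R) : (s - 1) / 2 < a -> eventually (fun k => log_rising a k <= 0).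
Proof.
move=> sa; have a1 : -1 < a by lra.
have d0 : 0 < 1 + 2 * a - s by lra.
(* Past M one has c <= 1 / M < 1 + 2 a - s, so a (1 + a) c >= - c cannot cancel the constant
   term. *)
have [M [HM M0]] := archimed_cor1 _ d0.
exists M => k /leP Mk.
have incr i : log_rising a (i + M)%N <= log_rising a (i.+1 + M)%N.
  rewrite addSn log_risingS //.
  have x01 : 0 < / INR (i + M).+1 <= 1.
    have := INR_S_ge1 (i + M) => n1; split; first by apply: Rinv_0_lt_compat; lra.
    by rewrite -Rinv_1; apply: Rinv_le_contravar; lra.
  have [c [K [cx [K0 ->]]]] := log_ratio_MVT s_gt0 a1 x01.
  suff : 0 <= K * (1 + 2 * a - s + a * (1 + a) * c) by lra.
  apply: Rmult_le_pos => //.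
  have : / INR (i + M).+1 <= / INR M.
    apply: Rinv_le_contravar; first exact: lt_0_INR.
    by apply: le_INR; apply/leP; rewrite -addSn leq_addl.
  have : -1 <= a * (1 + a) by nra.
  by nra.
have := is_lim_seq_incr_compare _ _ (proj1 (is_lim_seq_incr_n _ M _) (log_rising_lim a1)) incr (k -
  M)%N.
by rewrite (_ : Nat.add _ M = k) //; apply: subnK.
Qed.

(* Since [v <= exp v - 1 <= v / (1 - v)], the asymptotics of [log_rising] passes to its exponential. *)
Lemma rising_asymptotics :
  is_lim_seq (fun k => INR k.+1 * (l * rising s k / Rpower (INR k.+1) s - 1)) (s * (s - 1) / 2).
Proof.
pose v := log_rising 0; pose n k := INR k.+1.
have vE k : l * rising s k / Rpower (INR k.+1) s = exp (v k).
  rewrite /v /log_rising Rplus_0_r /Rminus exp_plus exp_Ropp exp_ln //.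
  by apply: Rmult_lt_0_compat => //; apply: rising_pos.
have lim_v : is_lim_seq v 0 by apply: log_rising_lim; lra.
have lim_nv : is_lim_seq (fun k => n k * v k) (s * (s - 1) / 2).
  apply/is_lim_seq_spec => eps; have e0 := cond_pos eps.
  (* One half of eps goes into the shift of the upper bound; the other covers the loss in the lower
     bound, a^2 / (n + a) <= 1 / n with a = (s - 1) / 2. *)
  have := log_rising_upper (a := (s - 1) / 2 + eps / 2) => /(_ _)[|M HM]; first lra.
  have [M' [HM' M0]] := archimed_cor1 _ (Rdiv_lt_0_compat _ _ e0 Rlt_0_2).
  exists (M + M')%N => k /leP Mk.
  have /HM : (M <= k)%coq_nat by apply/leP; apply: leq_trans Mk; rewrite leq_addr.
  have n1 := INR_S_ge1 k; rewrite -/(n k) in n1 *.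
  have n0 : 0 < n k by lra.
  have nk : / n k < eps / 2.
    apply: Rle_lt_trans HM'; apply: Rinv_le_contravar; first exact: lt_0_INR.
    by apply: le_INR; apply/leP; rewrite (leq_trans (leq_addl M M')) // (leq_trans Mk).
  have nip : 0 < / n k by apply: Rinv_0_lt_compat.
  have := log_rising_lower k.
  have na1 : 0 < n k + (s - 1) / 2 by lra.
  have na2 : 0 < n k + ((s - 1) / 2 + eps / 2) by lra.
  have [b1 _] := ln_shift_bounds n0 na1; have [_ b2] := ln_shift_bounds n0 na2.
  rewrite /v /log_rising Rplus_0_r -/(n k) => h1 h2.
  set a := (s - 1) / 2 in na1 na2 b1 b2 h1 h2 *; set L := ln (l * _) in h1 h2 *.
  have aE : s * (s - 1) / 2 = s * a by rewrite /a; field.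
  have sa : -1 / 2 <= a <= 0 by rewrite /a; lra.
  have c1 : n k * (a / (n k + a)) = a - a * a / (n k + a) by field; lra.
  have c2 : a * a / (n k + a) <= / n k.
    apply/Rle_div_l => //; apply: (Rmult_le_reg_l (n k)) => //.
    have a2 : a * a <= 1 / 4 by nra.
    have := Rmult_le_compat_l _ _ _ (Rlt_le _ _ n0) a2.
    by rewrite -(Rmult_assoc _ (/ _)) Rinv_r; lra.
  have c3 : n k * ((a + eps / 2) / n k) = a + eps / 2 by field; lra.
  have d1 : n k * (s * (a / (n k + a))) <= n k * (L - s * ln (n k)) by apply: Rmult_le_compat_l;
    nra.
  have d2 : n k * (L - s * ln (n k)) <= n k * (s * ((a + eps / 2) / n k))
    by apply: Rmult_le_compat_l; nra.
  by rewrite aE /=; apply: Rabs_def1; nra.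
apply: (is_lim_seq_ext (fun k => n k * (exp (v k) - 1))); first by move=> k; rewrite vE.
have ev : eventually (fun k => n k * v k <= n k * (exp (v k) - 1) <= n k * v k * / (1 - v k)).
  have /is_lim_seq_spec/(_ (mkposreal 1 Rlt_0_1))[M HM] := lim_v.
  exists M => k /HM; rewrite Rminus_0_r /= => /Rabs_def2 [v1 _].
  have n0 : 0 < n k by have := INR_S_ge1 k; rewrite /n; lra.
  split; first by apply: Rmult_le_compat_l; have := exp_ineq1_le (v k); lra.
  rewrite Rmult_assoc; apply: Rmult_le_compat_l; first lra.
  have ei : exp (v k) * exp (- v k) = 1 by rewrite -exp_plus Rplus_opp_r exp_0.
  have := exp_ineq1_le (- v k) => e1; have e2 := exp_pos (v k).
  apply: (Rmult_le_reg_r (1 - v k)); first lra.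
  by rewrite Rmult_assoc Rinv_l; nra.
apply: (is_lim_seq_le_le_loc _ _ _ _ ev lim_nv).
have {1}-> : s * (s - 1) / 2 = s * (s - 1) / 2 * / (1 - 0) by field.
apply: is_lim_seq_mult' => //; apply: (is_lim_seq_inv _ (1 - 0)); last by case; lra.
by apply: is_lim_seq_minus' => //; apply: is_lim_seq_const.
Qed.

End RisingLimit.

(** * From the integral equation to a recurrence *)

Section IntegralEquation.

Lemma lt_CV_radius (a : nat -> R) (x : R) :
  (forall y, Rabs y < 1 -> ex_pseries a y) -> Rabs x < 1 -> Rbar_lt (Rabs x) (CV_radius a).
Proof.
move=> aE x1; apply: Rbar_not_le_lt => le1.
pose y := (Rabs x + 1) / 2; have x0 := Rabs_pos x.
have yy : Rabs y = y by apply: Rabs_pos_eq; rewrite /y; lra.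
have y1 : Rabs y < 1 by rewrite yy /y; lra.
have : Rbar_lt (CV_radius a) (Rabs y).
  by apply: Rbar_le_lt_trans le1 _; rewrite /= yy /y; lra.
move/CV_disk_outside; apply; have [l Hl] := aE y y1.
apply: (is_lim_seq_ext (fun n => scal (pow_n y n) (a n))).
  by move=> n; rewrite pow_n_pow /scal /= /mult /= Rmult_comm.
by apply: ex_series_lim_0; exists l.
Qed.

Lemma is_RInt_gen_proj (f : R -> C) (l : C) (Fa Fb : (R -> Prop) -> Prop) :
  Filter Fa -> Filter Fb -> is_RInt_gen (V := C_R_NormedModule) f Fa Fb l ->
  is_RInt_gen (fun t => Re (f t)) Fa Fb (Re l) /\ is_RInt_gen (fun t => Im (f t)) Fa Fb (Im l).
Proof.
move=> FFa FFb /filterlimi_locally fl; split; apply/filterlimi_locally => eps.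
  apply: filter_imp (fl eps) => ab [y [iy ly]]; exists (Re y); split.
    exact: (is_RInt_fct_extend_fst (U := R_NormedModule) (V := R_NormedModule) f _ _ y iy).
  by case: ly.
apply: filter_imp (fl eps) => ab [y [iy ly]]; exists (Im y); split.
  exact: (is_RInt_fct_extend_snd (U := R_NormedModule) (V := R_NormedModule) f _ _ y iy).
by case: ly.
Qed.

Lemma is_RInt_gen_0_infty (f F : R -> R) (L : R) :
  (forall T, 0 < T -> is_RInt f 0 T (F T)) -> is_lim F p_infty L ->
  is_RInt_gen f (at_point 0) (Rbar_locally p_infty) L.
Proof.
move=> fF /filterlim_locally FL; apply/filterlimi_locally => eps.
have [M HM] := FL eps.
exists (fun a => a = 0) (fun b => Rmax 0 M < b); first by [].
  by exists (Rmax 0 M).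
move=> a b -> /= Mb; exists (F b); split.
  by apply: fF; apply: Rle_lt_trans Mb; apply: Rmax_l.
by apply: HM; apply: Rle_lt_trans Mb; apply: Rmax_r.
Qed.

(** [q] is arbitrary outside 1, ..., N; with those values cleared, the polynomial is a power series
    without constant term and can enter a Cauchy product. *)
Definition coefq (N : nat) (q : nat -> R) (i : nat) : R := if (1 <= i <= N)%N then q i else 0.

Lemma polyR_sum (N : nat) (q : nat -> R) (x : R) : polyR N q x = sum_n (fun j =>
  coefq N q j * x ^ j) N.
Proof.
rewrite /polyR /sum_n [RHS]sum_Sn_m; last exact: Nat.le_0_l.
rewrite {1}/coefq /= /plus /= Rmult_0_l Rplus_0_l.
by apply: sum_n_m_ext_loc => j [/leP j1 /leP jN]; rewrite /coefq j1 jN.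
Qed.

Lemma is_pseries_coefq (N : nat) (q : nat -> R) (x : R) :
  is_pseries (coefq N q) x (polyR N q x).
Proof.
apply: filterlim_ext_loc (filterlim_const _).
exists N => n /leP Nn; rewrite polyR_sum.
have -> : sum_n (fun k => scal (pow_n x k) (coefq N q k)) n = sum_n (fun j =>
  coefq N q j * x ^ j) n.
  by apply: sum_n_ext => k; rewrite pow_n_pow /scal /= /mult /= Rmult_comm.
elim: n Nn => [|n IHn]; first by rewrite leqn0 => /eqP ->.
rewrite leq_eqVlt => /orP[/eqP -> //|Nn].
by rewrite sum_Sn -IHn // /coefq (leqNgt n.+1) Nn andbF Rmult_0_l /plus /= Rplus_0_r.
Qed.

Variables (N : nat) (q : nat -> R).
Hypotheses (hN : (1 <= N)%N) (hq_ge0 : forall j : nat, (1 <= j <= N)%N -> 0 <= q j).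
Hypothesis hq_deg : q N <> 0.

Lemma coefq_ge0 (j : nat) : 0 <= coefq N q j.
Proof. by rewrite /coefq; case: ifP => [/hq_ge0|] //; lra. Qed.

Lemma polyR1_gt0 : 0 < polyR N q 1.
Proof.
have qN : 0 < coefq N q N.
  have := hq_ge0 (j := N); rewrite /coefq hN leqnn => /(_ isT) [] // qN; by case: hq_deg.
rewrite polyR_sum; case: (N) qN coefq_ge0 => [|n] qN pos; first by rewrite sum_O /=; lra.
rewrite sum_Sn /plus /= pow1 Rmult_1_r.
suff : 0 <= sum_n (fun j => coefq n.+1 q j * 1 ^ j) n by lra.
have <- : sum_n (fun _ => 0) n = 0 by rewrite sum_n_const Rmult_0_r.
by apply: sum_n_m_le => k; rewrite pow1 Rmult_1_r.
Qed.

(** Nonnegative coefficients and no constant term give q(x) <= |x| q(1). The strict inequality makes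
    the exponential in the integral equation decay. *)
Lemma polyR_lt (x : R) : Rabs x < 1 -> polyR N q x < polyR N q 1.
Proof.
move=> x1; have := polyR1_gt0.
suff : polyR N q x <= Rabs x * polyR N q 1 by nra.
rewrite !polyR_sum.
have -> : Rabs x * sum_n (fun j => coefq N q j * 1 ^ j) N = sum_n (fun j =>
  Rabs x * (coefq N q j * 1 ^ j)) N.
  exact: (esym (sum_n_mult_l (K := R_Ring) _ _ _)).
apply: sum_n_m_le => -[|k]; first by rewrite /coefq /=; lra.
rewrite pow1 Rmult_1_r Rmult_comm.
apply: Rmult_le_compat_r; first exact: coefq_ge0.
apply: Rle_trans (Rle_abs _) _; rewrite -RPow_abs /=.
have pk : Rabs x ^ k <= 1 by rewrite -(pow1 k); apply: pow_incr; have := Rabs_pos x; lra.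
by rewrite -[X in _ <= X]Rmult_1_r; apply: Rmult_le_compat_l; [apply: Rabs_pos|].
Qed.

Variables (a : nat -> R) (A : R -> R).
Hypotheses (a0 : a 0%N = 0) (aA : forall x, Rabs x < 1 -> is_pseries a x (A x)).
Hypothesis A_int : forall x, Rabs x < 1 ->
  is_RInt_gen (fun r => A (x * exp (r * (polyR N q x - polyR N q 1))))
    (at_point 0) (Rbar_locally p_infty) (A x / polyR N q 1).

(** Coefficients of the primitive of A(w) / w; at n = 0 the quotient is 0 because [a 0 = 0]. *)
Let g (n : nat) : R := a n / INR n.

Lemma lt_CV_coef (x : R) : Rabs x < 1 -> Rbar_lt (Rabs x) (CV_radius a).
Proof. by apply: lt_CV_radius => y /aA; exists (A y). Qed.

Lemma PS_derive_antideriv (n : nat) : PS_derive g n = PS_decr_1 a n.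
Proof. by rewrite /PS_derive /PS_decr_1 /g; field; apply: not_0_INR. Qed.

Lemma lt_CV_antideriv (x : R) : Rabs x < 1 -> Rbar_lt (Rabs x) (CV_radius g).
Proof.
rewrite -CV_radius_derive (CV_radius_ext _ _ PS_derive_antideriv) CV_radius_decr_1.
exact: lt_CV_coef.
Qed.

(* [r |-> PSeries g (x exp (r c))] is an antiderivative of [r |-> c A (x exp (r c))]. *)
Lemma antiderivative_equation (x : R) : Rabs x < 1 ->
  polyR N q 1 * PSeries g x = (polyR N q 1 - polyR N q x) * A x.
Proof.
move=> x1; have q1 := polyR1_gt0; have := polyR_lt x1; have := A_int x1.
set c := polyR N q x - polyR N q 1 => Ai qx.
have c0 : c < 0 by rewrite /c; lra.
have w1 r : 0 <= r -> Rabs (x * exp (r * c)) < 1.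
  move=> r0; rewrite Rabs_mult (Rabs_pos_eq (exp _)); last exact: Rlt_le (exp_pos _).
  have : exp (r * c) <= 1 by rewrite -exp_0; case: r0 => [r0|<-]; [apply: Rlt_le;
    apply: exp_increasing; nra|rewrite Rmult_0_l; lra].
  by have := exp_pos (r * c); have := Rabs_pos x; nra.
(* A(y) = y G'(y) with G the sum of [g], so the regularity of the integrand is that of a power
   series. *)
have AE y : Rabs y < 1 -> A y = y * PSeries (PS_derive g) y.
  move=> y1; rewrite -(is_pseries_unique _ _ _ (aA y1)).
  rewrite PSeries_decr_1; last by eexists; apply: aA.
  by rewrite a0 Rplus_0_l; congr (_ * _); apply: PSeries_ext => n; rewrite PS_derive_antideriv.
pose F T := PSeries g (x * exp (T * c)).
have dF r : 0 <= r -> is_derive F r (c * A (x * exp (r * c))).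
  move=> r0; have w := w1 r r0; rewrite AE //.
  have -> : c * (x * exp (r * c) * PSeries (PS_derive g) (x * exp (r * c)))
    = scal (x * (exp (r * c) * c)) (PSeries (PS_derive g) (x * exp (r * c))).
    by rewrite /scal /= /mult /=; ring.
  apply: is_derive_comp; first by apply: is_derive_PSeries; apply: lt_CV_antideriv.
  by auto_derive => //; ring.
have cont r : 0 <= r -> continuous (fun r =>
  c * (x * exp (r * c) * PSeries (PS_derive g) (x * exp (r * c)))) r.
  move=> r0; have w := w1 r r0; apply: ex_derive_continuous.
  have ed : ex_derive (PSeries (PS_derive g)) (x * exp (r * c)).
    by apply: ex_derive_PSeries; rewrite CV_radius_derive; apply: lt_CV_antideriv.
  by auto_derive.
have i1 : is_RInt_gen (fun r =>
  c * A (x * exp (r * c))) (at_point 0) (Rbar_locally p_infty) (0 - PSeries g x).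
  apply: (@is_RInt_gen_0_infty _ (fun T => F T - F 0)).
    move=> T T0.
    apply: (is_RInt_ext (fun r => c * (x * exp (r * c) * PSeries (PS_derive g) (x * exp (r * c))))).
      by move=> r; rewrite Rmin_left ?Rmax_right; try lra; move=> r0; rewrite AE //; apply: w1; lra.
    apply: (@is_RInt_derive R_CompleteNormedModule F) => r; rewrite Rmin_left ?Rmax_right;
      try lra; move=> r0.
      by rewrite -AE; [apply: dF|apply: w1]; lra.
    by apply: cont; lra.
  have -> : F 0 = PSeries g x by rewrite /F Rmult_0_l exp_0 Rmult_1_r.
  apply: is_lim_minus'; last exact: is_lim_const.
  have g0 : PSeries g 0 = 0 by rewrite PSeries_0 /g a0 /Rdiv Rmult_0_l.
  rewrite -g0; apply: (is_lim_comp_continuous (fun T => x * exp (T * c)) (PSeries g) p_infty 0);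
    last first.
    apply/continuity_pt_filterlim; apply: PSeries_continuity.
    by apply: lt_CV_antideriv; rewrite Rabs_R0; lra.
  have -> : 0 = x * 0 by ring.
  apply: (is_lim_scal_l (fun T => exp (T * c)) x p_infty 0).
  apply: (is_lim_comp exp _ p_infty 0 m_infty); first exact: is_lim_exp_m.
    have neg : is_Rbar_mult p_infty c m_infty by apply: is_Rbar_mult_p_infty_neg.
    rewrite -(is_Rbar_mult_unique _ _ _ neg).
    exact: (is_lim_scal_r id c p_infty p_infty (is_lim_id _)).
  by exists 0.
have i2 : is_RInt_gen (fun r =>
  c * A (x * exp (r * c))) (at_point 0) (Rbar_locally p_infty) (c * (A x / polyR N q 1)).
  exact: (is_RInt_gen_scal _ c _ Ai).
(* The same improper integral is 0 - G(x) by the antiderivative and c A(x) / q(1) by the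
   equation. *)
have := @is_RInt_gen_unique R_CompleteNormedModule _ _ _ _ _ _ i1.
rewrite (@is_RInt_gen_unique R_CompleteNormedModule _ _ _ _ _ _ i2) => E.
have -> : PSeries g x = - (c * (A x / polyR N q 1)) by rewrite E; ring.
by rewrite /c; field; lra.
Qed.

Lemma coef_recurrence (n : nat) :
  polyR N q 1 * (a n / INR n) = polyR N q 1 * a n - sum_f_R0 (fun k => coefq N q k * a (n - k)%N) n.
Proof.
pose u := PS_scal (polyR N q 1) g; pose v :=
  PS_minus (PS_scal (polyR N q 1) a) (PS_mult (coefq N q) a).
have uE x : Rabs x < 1 -> is_pseries u x (polyR N q 1 * PSeries g x).
  move=> x1; apply: is_pseries_scal; first exact: Rmult_comm.
  by apply: PSeries_correct; apply: CV_radius_inside; apply: lt_CV_antideriv.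
have vE x : Rabs x < 1 -> is_pseries v x (polyR N q 1 * A x - polyR N q x * A x).
  move=> x1; apply: is_pseries_minus.
    by apply: is_pseries_scal; [apply: Rmult_comm|apply: aA].
  apply: is_pseries_mult; [exact: is_pseries_coefq|exact: aA| |exact: lt_CV_coef].
  by apply: lt_CV_radius => // y _; eexists; apply: is_pseries_coefq.
have R0 : Rabs 0 < 1 by rewrite Rabs_R0; lra.
have : u n = v n.
  apply: PSeries_ext_recip.
  - by rewrite -Rabs_R0; apply: lt_CV_radius => // y /uE; eexists; eassumption.
  - by rewrite -Rabs_R0; apply: lt_CV_radius => // y /vE; eexists; eassumption.
  exists (mkposreal 1 Rlt_0_1) => x;
    rewrite /ball /= /AbsRing_ball /abs /minus /plus /opp /= Ropp_0 Rplus_0_r => x1.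
  rewrite (is_pseries_unique _ _ _ (uE x x1)) (is_pseries_unique _ _ _ (vE x x1))
    antiderivative_equation //.
  by ring.
by [].
Qed.

End IntegralEquation.

(** * Real and imaginary parts of series, derivatives and convolutions *)

Section ComplexToReal.

Lemma C_ext (z w : C) : Re z = Re w -> Im z = Im w -> z = w.
Proof. by case: z => a b; case: w => c d /= -> ->. Qed.

Lemma Re_sum_n (f : nat -> C) (n : nat) :
  Re (sum_n (G := C_NormedModule) f n) = sum_n (fun k => Re (f k)) n.
Proof. by elim: n => [|n IHn]; rewrite ?sum_O // !sum_Sn -IHn. Qed.

Lemma Im_sum_n (f : nat -> C) (n : nat) :
  Im (sum_n (G := C_NormedModule) f n) = sum_n (fun k => Im (f k)) n.
Proof. by elim: n => [|n IHn]; rewrite ?sum_O // !sum_Sn -IHn. Qed.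

Lemma filterlim_C_iff (T : Type) (F : (T -> Prop) -> Prop) (f : T -> C) (l : C) : Filter F ->
  filterlim f F (locally (T := C_UniformSpace) l) <->
  filterlim (fun t => Re (f t)) F (locally (Re l)) /\ filterlim (fun t =>
    Im (f t)) F (locally (Im l)).
Proof.
move=> FF; split.
  move=> /filterlim_locally fl; split; apply/filterlim_locally => eps;
    by apply: filter_imp (fl eps) => t [].
case=> /filterlim_locally f1 /filterlim_locally f2; apply/filterlim_locally => eps.
exact: filter_and (f1 eps) (f2 eps).
Qed.

Lemma is_series_C_iff (f : nat -> C) (l : C) :
  is_series (K := C_AbsRing) (V := C_NormedModule) f l <->
  is_series (fun k => Re (f k)) (Re l) /\ is_series (fun k => Im (f k)) (Im l).
Proof.
rewrite /is_series; split.
  move/filterlim_C_iff => [f1 f2]; split.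
    by apply: filterlim_ext f1 => n; rewrite Re_sum_n.
  by apply: filterlim_ext f2 => n; rewrite Im_sum_n.
case=> f1 f2; apply/filterlim_C_iff; split.
  by apply: filterlim_ext f1 => n; rewrite Re_sum_n.
by apply: filterlim_ext f2 => n; rewrite Im_sum_n.
Qed.

(** The modulus of the complex error term dominates its real and imaginary parts, so restricting to
    real increments suffices. *)
Lemma is_derive_C_real (f : C -> C) (x : R) (l : C) :
  is_derive (K := C_AbsRing) (V := C_NormedModule) f (RtoC x) l ->
  is_derive (fun t : R => Re (f (RtoC t))) x (Re l) /\ is_derive (fun t : R =>
    Im (f (RtoC t))) x (Im l).
Proof.
move=> [_ /(_ _ (fun P H => H)) fl].
have key (eps : posreal) : locally x (fun t : R => Cmod (f t - f x - (t - x) * l)%C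
  <= eps * Rabs (t - x)).
  have [d Hd] := fl eps; exists d => t tx; have := Hd (RtoC t).
  have -> : (f t - f x - (t - x) * l)%C
     = minus (minus (f t) (f x)) (scal (minus (RtoC t) (RtoC x)) l) by [].
  move=> H; refine (Rle_trans _ _ _ (H _) _).
    by change (Cmod (t - x)%C < d); rewrite -RtoC_minus Cmod_R.
  change (eps * Cmod (t - x)%C <= eps * Rabs (t - x)).
  by apply: Req_le; congr (_ * _); rewrite -Cmod_R RtoC_minus.
split; split; try exact: is_linear_scal_l.
  move=> y /is_filter_lim_locally_unique <- eps; apply: filter_imp (key eps) => t.
  apply: Rle_trans; apply: Rle_trans (re_le_Cmod _); apply: Req_le; rewrite /norm /= /abs /=.
  congr Rabs; rewrite /minus /plus /opp /scal /= /mult /= /Re; ring.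
move=> y /is_filter_lim_locally_unique <- eps; apply: filter_imp (key eps) => t.
apply: Rle_trans; set z := (_ - _)%C; apply: Rle_trans (Rle_trans _ _ _ (Rmax_r _ _) (Rmax_Cmod z)).
apply: Req_le; rewrite /norm /= /abs /=.
by congr Rabs; rewrite /z /minus /plus /opp /scal /= /mult /= /Im; ring.
Qed.

Lemma Cexp_RtoC (y : R) : Cexp (RtoC y) = RtoC (exp y).
Proof. by rewrite /Cexp /= cos_0 sin_0 Rmult_1_r Rmult_0_r. Qed.

Lemma polyC_RtoC (N : nat) (q : nat -> R) (x : R) : polyC N q (RtoC x) = RtoC (polyR N q x).
Proof.
rewrite /polyC /polyR; elim: N => [|N IHN]; first by rewrite !sum_n_m_zero //; lia.
rewrite !sum_n_Sm; try lia; rewrite IHN RtoC_plus RtoC_mult.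
by rewrite RtoC_pow.
Qed.

Lemma Re_sum (f : nat -> C) (n : nat) :
  Re (\sum_(i < n.+1) f i)%R = sum_f_R0 (fun i => Re (f i)) n.
Proof.
elim: n => [|n IHn]; first by rewrite big_ord_recr big_ord0 /= Rplus_0_l.
by rewrite big_ord_recr /= -IHn.
Qed.

Lemma Im_sum (f : nat -> C) (n : nat) :
  Im (\sum_(i < n.+1) f i)%R = sum_f_R0 (fun i => Im (f i)) n.
Proof.
elim: n => [|n IHn]; first by rewrite big_ord_recr big_ord0 /= Rplus_0_l.
by rewrite big_ord_recr /= -IHn.
Qed.

Lemma Re_RtoC_mult (x : R) (z : C) : Re (RtoC x * z)%C = x * Re z.
Proof. by rewrite /Re /=; ring. Qed.

Lemma Im_RtoC_mult (x : R) (z : C) : Im (RtoC x * z)%C = x * Im z.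
Proof. by rewrite /Im /=; ring. Qed.

Lemma Re_conv_RtoC (x : nat -> R) (f : nat -> C) (n : nat) :
  Re (conv (fun i => RtoC (x i)) f n) = sum_f_R0 (fun i => x i * Re (f (n - i)%N)) n.
Proof.
rewrite [LHS](Re_sum (fun i => RtoC (x i) * f (n - i)%N)%C).
by apply: PartSum.sum_eq => i _; rewrite Re_RtoC_mult.
Qed.

Lemma Im_conv_RtoC (x : nat -> R) (f : nat -> C) (n : nat) :
  Im (conv (fun i => RtoC (x i)) f n) = sum_f_R0 (fun i => x i * Im (f (n - i)%N)) n.
Proof.
rewrite [LHS](Im_sum (fun i => RtoC (x i) * f (n - i)%N)%C).
by apply: PartSum.sum_eq => i _; rewrite Im_RtoC_mult.
Qed.

End ComplexToReal.

(** * Recurrence for the coefficients of the analytic solution *)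

Section SolutionCoefficients.
Variables (N : nat) (q : nat -> R) (Phi : C -> C) (phi : nat -> C).
Hypotheses (hN : (1 <= N)%N) (hq_ge0 : forall j : nat, (1 <= j <= N)%N -> 0 <= q j).
Hypotheses (hq_deg : q N <> 0) (hPhi : analytic_solution N q Phi).
Hypothesis hphi : forall z : C, Cmod z < 1 ->
  is_series (K := C_AbsRing) (V := C_NormedModule)
    (fun k : nat => (phi k.+1 * z ^ k.+1)%C) (Phi z).

(** The expansion of Phi starts at z and leaves [phi 0] free; the constant term is set to 0, in
    agreement with Phi(0) = 0. *)
Let a1 (k : nat) : R := if k is 0 then 0 else Re (phi k).
Let a2 (k : nat) : R := if k is 0 then 0 else Im (phi k).

Lemma pseries_solution (x : R) : Rabs x < 1 ->
  is_pseries a1 x (Re (Phi x)) /\ is_pseries a2 x (Im (Phi x)).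
Proof.
move=> x1; have : Cmod x < 1 by rewrite Cmod_R.
move/hphi/is_series_C_iff => [s1 s2]; split; apply: is_series_decr_1.
  have -> : plus (Re (Phi x)) (opp (scal (pow_n x 0) (a1 0))) = Re (Phi x).
    by rewrite /a1 /plus /opp /scal /= /mult /=; ring.
  apply: is_series_ext s1 => k.
  by rewrite -RtoC_pow pow_n_pow /scal /= /mult /= /a1 /Re; ring.
have -> : plus (Im (Phi x)) (opp (scal (pow_n x 0) (a2 0))) = Im (Phi x).
  by rewrite /a2 /plus /opp /scal /= /mult /=; ring.
apply: is_series_ext s2 => k.
by rewrite -RtoC_pow pow_n_pow /scal /= /mult /= /a2 /Im; ring.
Qed.

(** For real x the argument of Phi in the integral is real for every r, so the equation splits into
    one for Re Phi and one for Im Phi. *)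
Lemma integral_solution (x : R) : Rabs x < 1 ->
  is_RInt_gen (fun r => Re (Phi (RtoC (x * exp (r * (polyR N q x - polyR N q 1))))))
    (at_point 0) (Rbar_locally p_infty) (Re (Phi x) / polyR N q 1) /\
  is_RInt_gen (fun r => Im (Phi (RtoC (x * exp (r * (polyR N q x - polyR N q 1))))))
    (at_point 0) (Rbar_locally p_infty) (Im (Phi x) / polyR N q 1).
Proof.
move=> x1; have : Cmod x < 1 by rewrite Cmod_R.
have [_ Hint _ _] := hPhi; move/Hint; rewrite !polyC_RtoC.
have -> : (Phi x / polyR N q 1)%C = (Re (Phi x) / polyR N q 1, Im (Phi x) / polyR N q 1).
  rewrite /Cdiv -RtoC_inv; last by have := polyR1_gt0 hN hq_ge0 hq_deg; lra.
  by apply: C_ext; rewrite /= /Re /Im /Rdiv; ring.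
move=> H; have [i1 i2] := @is_RInt_gen_proj _ _ _ _ _ _ H; split.
  apply: is_RInt_gen_ext i1; apply: filter_forall => ab r _.
  by rewrite -RtoC_minus -RtoC_mult Cexp_RtoC -RtoC_mult.
apply: is_RInt_gen_ext i2; apply: filter_forall => ab r _.
by rewrite -RtoC_minus -RtoC_mult Cexp_RtoC -RtoC_mult.
Qed.

Lemma solution_phi1 : phi 1 = RtoC 1.
Proof.
have [_ _ _ /is_derive_C_real[d1 d2]] := hPhi.
have der (a : nat -> R) (A : R -> R) (l : R) :
    (forall x, Rabs x < 1 -> is_pseries a x (A x)) -> is_derive A 0 l -> a 1%N = l.
  move=> aA dA; have r1 : Rbar_lt (Rabs 0) (CV_radius a).
    by apply: lt_CV_radius => [y /aA ?|]; [eexists; eassumption|rewrite Rabs_R0; lra].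
  have := is_derive_PSeries a 0 r1; rewrite PSeries_0 /PS_derive /= Rmult_1_l => da.
  have dA' : is_derive A 0 (a 1%N).
    apply: is_derive_ext_loc da; exists (mkposreal 1 Rlt_0_1) => y.
    rewrite /ball /= /AbsRing_ball /abs /minus /plus /opp /= Ropp_0 Rplus_0_r => /aA.
    exact: is_pseries_unique.
  by rewrite -(is_derive_unique _ _ _ dA') (is_derive_unique _ _ _ dA).
apply: C_ext.
  exact: (der a1 (fun x => Re (Phi x)) _ (fun x x1 => proj1 (pseries_solution x1)) d1).
exact: (der a2 (fun x => Im (Phi x)) _ (fun x x1 => proj2 (pseries_solution x1)) d2).
Qed.

Lemma solution_recurrence (k : nat) :
  ((RtoC (polyR N q 1) * phi k.+1) *+ k =
   conv (fun i => RtoC (coefq N q i)) (fun i => phi i.+1) k *+ k.+1)%R.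
Proof.
have c1 := coef_recurrence hN hq_ge0 hq_deg (erefl : a1 0 = 0)
  (fun x x1 => proj1 (pseries_solution x1)) (fun x x1 => proj1 (integral_solution x1)) k.+1.
have c2 := coef_recurrence hN hq_ge0 hq_deg (erefl : a2 0 = 0)
  (fun x x1 => proj2 (pseries_solution x1)) (fun x x1 => proj2 (integral_solution x1)) k.+1.
have n0 : INR k.+1 <> 0 by apply: not_0_INR.
have solve (x S : R) : polyR N q 1 * (x / INR k.+1) = polyR N q 1 * x - S ->
    polyR N q 1 * x * INR k = S * INR k.+1.
  move=> E; have -> : S = polyR N q 1 * x - polyR N q 1 * (x / INR k.+1) by lra.
  by rewrite [in INR k](_ : INR k = INR k.+1 - 1); [field|rewrite S_INR; ring].
(* Passing to the sequence phi_(i+1) shortens the convolution by its top term, which carries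
   [a 0]. *)
have last_term (a : nat -> R) : a 0%N = 0 ->
    sum_f_R0 (fun i => coefq N q i * a (k.+1 - i)%N) k.+1 = sum_f_R0 (fun i =>
      coefq N q i * a (k - i)%N.+1) k.
  move=> a0; rewrite /= subnn a0 Rmult_0_r Rplus_0_r.
  by apply: PartSum.sum_eq => i /leP ik; rewrite subSn.
rewrite !C_mulrnE ![(_ * RtoC (INR _))%C]Cmult_comm.
rewrite -[(RtoC (polyR N q 1) * phi k.+1)%R]/(RtoC (polyR N q 1) * phi k.+1)%C; apply: C_ext.
  rewrite !Re_RtoC_mult Re_conv_RtoC !(Rmult_comm (INR _)).
  by rewrite (solve _ _ c1) last_term.
rewrite !Im_RtoC_mult Im_conv_RtoC !(Rmult_comm (INR _)).
by rewrite (solve _ _ c2) last_term.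
Qed.

End SolutionCoefficients.

(** * The explicit coefficients *)

Section PolynomialBridge.
Import GRing.Theory.
Local Open Scope ring_scope.

Lemma is_derive_horner (p : {poly C}) (z : C) :
  is_derive (K := C_AbsRing) (V := AbsRing_NormedModule C_AbsRing) (fun z : C => p.[z]) z p^`().[z].
Proof.
elim/poly_ind: p z => [|p c IHp] z.
  rewrite derivC horner0; apply: is_derive_ext (is_derive_const _ _) => t.
  by rewrite horner0.
rewrite derivMXaddC hornerD hornerMX [X in is_derive _ _ X]addrC.
apply: (@is_derive_ext C_AbsRing (AbsRing_NormedModule C_AbsRing) (fun t : C => (p.[t] * t + c)%C)).
  by move=> t; rewrite hornerMXaddC.
have -> : p^`().[z] * z + p.[z] = ((p^`().[z] * z + p.[z] * 1) + 0)%C.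
  by rewrite Cmult_1_r Cplus_0_r.
apply: is_derive_plus; last exact: is_derive_const.
by apply: (@is_derive_mult C_AbsRing) => //; [apply: is_derive_id|apply: Cmult_comm].
Qed.

Variables (N : nat) (q : nat -> R).

Definition polyq : {poly C} := \poly_(i < N.+1) RtoC (coefq N q i).

Lemma horner_polyq (z : C) : polyq.[z] = polyC N q z.
Proof.
rewrite horner_poly /polyC.
have -> : sum_n_m (fun j => (RtoC (q j) * z ^ j)%C) 1 N = sum_n (G := C_AbelianGroup) (fun j =>
  (RtoC (coefq N q j) * z ^ j)%C) N.
  rewrite /sum_n [RHS]sum_Sn_m; last exact: Nat.le_0_l.
  rewrite {1}/coefq /= [LHS](esym (plus_zero_l _)); congr plus; first by rewrite /zero /= Cmult_0_l.
  by apply: sum_n_m_ext_loc => j [/leP j1 /leP jN]; rewrite /coefq j1 jN.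
move: (coefq N q) => f; elim: (N) => [|n IHn].
  by rewrite big_ord_recr big_ord0 sum_O /= add0r C_expE.
by rewrite big_ord_recr sum_Sn -IHn /= C_expE.
Qed.

Lemma C_derive_polyC (z : C) : C_derive (polyC N q) z = polyq^`().[z].
Proof.
apply: is_C_derive_unique.
(* The derivative is transferred, component by component, from one normed-module structure on C to
   the other. *)
have H : is_derive (K := C_AbsRing) (V := C_NormedModule) (horner polyq) z polyq^`().[z].
  by case: (is_derive_horner polyq z) => -[l1 l2 l3] D; split=> //; split.
by apply: (is_derive_ext (horner polyq)) => // t; rewrite horner_polyq.
Qed.

Hypotheses (hN : (1 <= N)%N) (hq_ge0 : forall j : nat, (1 <= j <= N)%N -> Rle 0 (q j)).
Hypothesis hq_deg : q N <> IZR 0.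
Variable b : 'I_N -> C.
Hypothesis hb_zeros : forall z : C, polyC N q z = polyC N q (RtoC 1) <-> exists j : 'I_N, z = b j.
Hypothesis hb_distinct : forall i j : 'I_N, i <> j -> b i <> b j.

Let q1 : C := RtoC (polyR N q (IZR 1)).

Definition shifted_polyq : {poly C} := polyq - q1%:P.

Lemma polyC_at1 : polyC N q (RtoC 1) = q1.
Proof. exact: polyC_RtoC. Qed.

Lemma q1_neq0 : q1 != 0.
Proof. by apply/eqP => /RtoC_inj; have := polyR1_gt0 hN hq_ge0 hq_deg; lra. Qed.

Lemma shifted_polyq0 : shifted_polyq.[0] = - q1.
Proof.
rewrite hornerD hornerN hornerC -[X in X + _ = _](_ : 0 = _) ?add0r //.
by rewrite horner_coef0 coef_poly.
Qed.

Lemma coef_polyq (i : nat) : polyq`_i = RtoC (coefq N q i).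
Proof.
rewrite coef_poly ltnS; case: leqP => // Ni.
by rewrite /coefq (leqNgt i) Ni andbF.
Qed.

Lemma size_shifted_polyq : size shifted_polyq = N.+1.
Proof.
have sq : size polyq = N.+1.
  apply: size_poly_eq; rewrite /coefq hN leqnn.
  by apply/eqP => /RtoC_inj.
by rewrite size_polyDl ?sq // size_polyN size_polyC q1_neq0 ltnS.
Qed.

Lemma b_inj : injective b.
Proof. by move=> i j E; apply: contrapT => /hb_distinct. Qed.

Lemma shifted_polyqE : shifted_polyq = lead_coef shifted_polyq *: rootp b (index_enum 'I_N).
Proof.
rewrite rootpE -(big_map b predT (fun z => 'X - z%:P)); apply: all_roots_prod_XsubC.
- by rewrite size_shifted_polyq size_map -[index_enum _]enumT -cardT card_ord.
- apply/allP => _ /mapP[j _ ->]; rewrite /root /shifted_polyq hornerD hornerN hornerC horner_polyq.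
  by rewrite (proj2 (hb_zeros (b j))) ?polyC_at1 ?subrr //; exists j.
- by rewrite uniq_rootsE map_inj_uniq; [exact: index_enum_uniq|exact: b_inj].
Qed.

Lemma lead_shifted_polyq_neq0 : lead_coef shifted_polyq != 0.
Proof. by rewrite lead_coef_eq0 -size_poly_eq0 size_shifted_polyq. Qed.

Lemma deriv_shifted_polyq : shifted_polyq^`() = polyq^`().
Proof. by rewrite derivB derivC subr0. Qed.

Lemma expoE (j : 'I_N) : expo N q (b j) = - 1 - q1 / (shifted_polyq^`().[b j] * b j).
Proof.
rewrite /expo polyC_at1 C_derive_polyC deriv_shifted_polyq.
by rewrite (_ : RtoC (IZR (-1)) = (- RtoC 1)%C) // -RtoC_opp.
Qed.

Lemma uniq_b (s : seq 'I_N) : uniq s -> uniq [seq b j | j <- s].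
Proof. by rewrite map_inj_uniq //; apply: b_inj. Qed.

Lemma b_neq0 (j : 'I_N) : b j != 0.
Proof.
exact: (root_neq0 shifted_polyqE q1_neq0 shifted_polyq0 (mem_index_enum j)).
Qed.

Let f (j : 'I_N) : nat -> C := binom_coef (expo N q (b j)) (b j).

Lemma binom_coef_rec (j : 'I_N) (i : nat) :
  b j * (f j i.+1 *+ i.+1) = (i%:R - expo N q (b j)) * f j i.
Proof. by rewrite C_mulrnE C_natrE; apply: binom_coefS; apply/eqP/b_neq0. Qed.

(** Both sequences obey the recurrence and start at 1. The enumeration s is left free so that the
    asymptotic part can put the root 1 first. *)
Lemma coef_conv_prod (phi : nat -> C) (s : seq 'I_N) :
  perm_eq s (index_enum 'I_N) -> phi 1%N = 1 ->
  (forall k, (q1 * phi k.+1) *+ k = conv (fun i => RtoC (coefq N q i)) (fun i =>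
    phi i.+1) k *+ k.+1) ->
  forall k, phi k.+1 = conv_prod f s k.
Proof.
move=> ps p1 prec k; rewrite (conv_prod_perm _ ps).
apply: (recurrence_unique C_natS_neq0 q1_neq0 _ _ prec).
- by rewrite /coefq.
- rewrite p1; elim: (index_enum _) => //= j s' IHs'.
  by rewrite /conv big_ord_recl big_ord0 /= -IHs' /f binom_coef0 mulr1 addr0.
move=> i; have := conv_prod_recurrence (uniq_b (index_enum_uniq _)) shifted_polyqE
  lead_shifted_polyq_neq0 q1_neq0 shifted_polyq0 expoE i binom_coef_rec.
move=> ->; congr (_ *+ _); apply: eq_bigr => k' _; congr (_ * _).
by rewrite /shifted_polyq subrK coef_polyq.
Qed.

End PolynomialBridge.

(** * Series with geometric decay *)

Section GeometricDecay.

(** The power series with coefficients f has radius of convergence larger than 1. This is stable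
    under convolution and under multiplication by n, and gives absolute convergence at 1. *)
Definition geo (f : nat -> C) : Prop :=
  exists K r, 0 <= r < 1 /\ forall n, Cmod (f n) <= K * r ^ n.

Lemma INR_pow_le (r : R) (n : nat) : 0 <= r < 1 -> INR n.+1 * r ^ n * (1 - r) <= 1.
Proof.
(* Each of the n + 1 terms of 1 + r + ... + r^n is at least r^n; times 1 - r, the sum is 1 -
   r^(n+1), a bound that induction can carry. *)
move=> r01; apply: Rle_trans (_ : 1 - r ^ n.+1 <= 1); last first.
  by have := pow_le r n.+1 (proj1 r01); lra.
elim: n => [|n IHn]; first by rewrite /=; lra.
rewrite (S_INR n.+1).
have p0 : 0 <= r ^ n.+1 by apply: pow_le; lra.
have p1 : r ^ n.+1 <= 1 by rewrite -(pow1 n.+1); apply: pow_incr; lra.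
have -> : (INR n.+1 + 1) * r ^ n.+1 * (1 - r)
  = r * (INR n.+1 * r ^ n * (1 - r)) + r ^ n.+1 * (1 - r).
  by rewrite -tech_pow_Rmult; ring.
have : r * (INR n.+1 * r ^ n * (1 - r)) <= r * (1 - r ^ n.+1) by apply: Rmult_le_compat_l; lra.
rewrite -(tech_pow_Rmult r n.+1); nra.
Qed.

(** Half of the decay absorbs the factor n + 1: r^n is the square of (sqrt r)^n, and (n + 1) (sqrt
    r)^n <= 1 / (1 - sqrt r). *)
Lemma geo_INR_S (K r : R) (f : nat -> C) : 0 <= r < 1 ->
  (forall n, Cmod (f n) <= K * INR n.+1 * r ^ n) -> geo f.
Proof.
move=> r01 fK; have K0 : 0 <= K by have := fK 0%N; have := Cmod_ge_0 (f 0%N); rewrite /=; lra.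
have sr0 := sqrt_pos r; have srr := sqrt_sqrt r (proj1 r01).
have sr1 : sqrt r < 1 by rewrite -sqrt_1; apply: sqrt_lt_1_alt.
exists (K / (1 - sqrt r)), (sqrt r); split; first by [].
move=> n; apply: Rle_trans (fK n) _; rewrite -{1}srr Rpow_mult_distr /Rdiv !Rmult_assoc.
apply: Rmult_le_compat_l => //; rewrite -!Rmult_assoc.
apply: Rmult_le_compat_r; first exact: pow_le.
have r01' : 0 <= sqrt r < 1 by lra.
by have := INR_pow_le n r01' => h; apply: (Rmult_le_reg_r (1 - sqrt r)); [lra|rewrite Rinv_l; lra].
Qed.

Lemma geo_INR_mult (f : nat -> C) : geo f -> geo (fun n => RtoC (INR n) * f n)%C.
Proof.
move=> [K [r [r01 fK]]]; apply: (geo_INR_S (K := K) r01) => n.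
rewrite Cmod_mult Cmod_R Rabs_pos_eq; last exact: pos_INR.
have := fK n; have := Cmod_ge_0 (f n); have := pos_INR n; rewrite S_INR; nra.
Qed.

Lemma Cmod_sum_le (f : nat -> C) (B : R) (n : nat) : (forall i, (i <= n)%N -> Cmod (f i) <= B) ->
  Cmod (\sum_(i < n.+1) f i)%R <= INR n.+1 * B.
Proof.
elim: n => [|n IHn] fB.
  by rewrite big_ord_recr big_ord0 /= GRing.add0r Rmult_1_l; apply: fB.
rewrite big_ord_recr S_INR; apply: Rle_trans (Cmod_triangle (\sum_(i < n.+1) f i)%R (f n.+1)) _.
have := fB n.+1 (leqnn _); have : Cmod (\sum_(i < n.+1) f i)%R <= INR n.+1 * B; last by lra.
by apply: IHn => i /leqW; apply: fB.
Qed.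

Lemma geo_conv (f g : nat -> C) : geo f -> geo g -> geo (conv f g).
Proof.
move=> [K [r [r01 fK]]] [L [p [p01 gL]]].
have [m0 m1] : 0 <= Rmax r p /\ Rmax r p < 1 by have := Rmax_l r p; split;
  [lra|apply: Rmax_lub_lt; lra].
apply: (geo_INR_S (K := K * L) (r := Rmax r p)) => // n.
rewrite (Rmult_comm (K * L)) Rmult_assoc.
apply: (Cmod_sum_le (f := fun i => (f i * g (n - i)%N)%C)) => i lein.
rewrite Cmod_mult.
have -> : K * L * Rmax r p ^ n = (K * Rmax r p ^ i) * (L * Rmax r p ^ (n - i)).
  have {1}-> : n = (i + (n - i))%coq_nat by rewrite -[LHS](subnKC lein).
  by rewrite pow_add; ring.
have K0 : 0 <= K by have := fK 0%N; have := Cmod_ge_0 (f 0%N); rewrite /=; lra.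
have L0 : 0 <= L by have := gL 0%N; have := Cmod_ge_0 (g 0%N); rewrite /=; lra.
apply: Rmult_le_compat; try exact: Cmod_ge_0.
  apply: Rle_trans (fK i) _; apply: Rmult_le_compat_l => //.
  by apply: pow_incr; split; [lra|apply: Rmax_l].
apply: Rle_trans (gL _) _; apply: Rmult_le_compat_l => //.
by apply: pow_incr; split; [lra|apply: Rmax_r].
Qed.

Lemma ex_series_geo_Rabs (a : nat -> R) (f : nat -> C) : geo f ->
  (forall n, Rabs (a n) <= Cmod (f n)) -> ex_series (fun n => Rabs (a n)).
Proof.
move=> [K [r [r01 fK]]] af.
apply: (@ex_series_le R_AbsRing R_CompleteNormedModule _ (fun n => K * r ^ n)).
  by move=> n; rewrite /norm /= /abs /= Rabs_Rabsolu; apply: Rle_trans (af n) (fK n).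
apply: (@ex_series_scal_l R_AbsRing R_NormedModule).
by apply: ex_series_geom; rewrite Rabs_pos_eq; lra.
Qed.

Lemma Im_le_Cmod (z : C) : Rabs (Im z) <= Cmod z.
Proof. exact: Rle_trans (Rmax_r _ _) (Rmax_Cmod z). Qed.

Lemma geo_ex_series (f : nat -> C) : geo f ->
  exists l, is_series (K := C_AbsRing) (V := C_NormedModule) f l.
Proof.
move=> gf.
have [a Ha] := ex_series_Rabs _ (ex_series_geo_Rabs gf (fun n => re_le_Cmod (f n))).
have [b Hb] := ex_series_Rabs _ (ex_series_geo_Rabs gf (fun n => Im_le_Cmod (f n))).
by exists (a, b); apply/is_series_C_iff.
Qed.

Lemma is_series_conv (f g : nat -> C) (a b : C) : geo f -> geo g ->
  is_series (K := C_AbsRing) (V := C_NormedModule) f a ->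
  is_series (K := C_AbsRing) (V := C_NormedModule) g b ->
  is_series (K := C_AbsRing) (V := C_NormedModule) (conv f g) (a * b)%C.
Proof.
move=> gf gg /is_series_C_iff [fr fi] /is_series_C_iff [hr hi].
have afr := ex_series_geo_Rabs gf (fun n => re_le_Cmod (f n)).
have afi := ex_series_geo_Rabs gf (fun n => Im_le_Cmod (f n)).
have agr := ex_series_geo_Rabs gg (fun n => re_le_Cmod (g n)).
have agi := ex_series_geo_Rabs gg (fun n => Im_le_Cmod (g n)).
apply/is_series_C_iff; split.
  have := is_series_minus _ _ _ _ (is_series_mult _ _ _ _ fr hr afr agr) (is_series_mult _ _ _ _ fi
    hi afi agi).
  apply: is_series_ext => n.
  rewrite [RHS](Re_sum (fun i => f i * g (n - i)%N)%C) /plus /opp /=.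
  by rewrite -[LHS]minus_sum; apply: PartSum.sum_eq.
have := is_series_plus _ _ _ _ (is_series_mult _ _ _ _ fr hi afr agi) (is_series_mult _ _ _ _ fi hr
  afi agr).
apply: is_series_ext => n.
rewrite [RHS](Im_sum (fun i => f i * g (n - i)%N)%C) /plus /=.
by rewrite -[LHS]plus_sum; apply: PartSum.sum_eq.
Qed.

(** Multiplying coefficients by n is the derivation z d/dz; here n = i + (n - i). *)
Lemma conv_INR_mult (f g : nat -> C) (n : nat) :
  (RtoC (INR n) * conv f g n)%C =
  (conv (fun i => RtoC (INR i) * f i)%C g n + conv f (fun i => RtoC (INR i) * g i)%C n)%C.
Proof.
transitivity (\sum_(i < n.+1) (RtoC (INR n) * (f i * g (n - i)%N)))%R.
  exact: GRing.mulr_sumr.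
transitivity (\sum_(i < n.+1) ((RtoC (INR i) * f i) * g (n - i)%N
    + f i * (RtoC (INR (n - i)%N) * g (n - i)%N)))%R; last exact: big_split.
apply: eq_bigr => i _.
have -> : INR n = INR i + INR (n - i)%N by rewrite -plus_INR plusE subnKC // -ltnS.
rewrite RtoC_plus -[RHS]/((RtoC (INR i) * f i) * g (n - i)%N + f i * (RtoC (INR (n - i)%N) * g (n -
  i)%N))%C.
by rewrite -[LHS]/((RtoC (INR i) + RtoC (INR (n - i)%N)) * (f i * g (n - i)%N))%C; ring.
Qed.

Lemma is_series_single (f : nat -> C) : (forall n, f n.+1 = RtoC 0) ->
  is_series (K := C_AbsRing) (V := C_NormedModule) f (f 0%N).
Proof.
move=> f0; apply: filterlim_ext (filterlim_const _).
by elim=> [|n IHn]; rewrite ?sum_O // sum_Sn -IHn f0 plus_zero_r.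
Qed.

(** With F_j the series of [f j], the hypotheses say e_j = F_j(1) and e_j d_j = F_j'(1); the last
    conclusion is logarithmic differentiation of the product at 1. Its induction step needs the
    other two conclusions. *)
Lemma is_series_conv_prod (I : eqType) (f : I -> nat -> C) (e d : I -> C) (s : seq I) :
  {in s, forall j, geo (f j)} ->
  {in s, forall j, is_series (K := C_AbsRing) (V := C_NormedModule) (f j) (e j)} ->
  {in s, forall j, is_series (K := C_AbsRing) (V := C_NormedModule)
    (fun n => RtoC (INR n) * f j n)%C (e j * d j)%C} ->
  [/\ geo (conv_prod f s),
      is_series (K := C_AbsRing) (V := C_NormedModule) (conv_prod f s) (\prod_(j <- s) e j)%R
    & is_series (K := C_AbsRing) (V := C_NormedModule) (fun n => RtoC (INR n) * conv_prod f s n)%C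
        ((\prod_(j <- s) e j)%R * (\sum_(j <- s) d j)%R)%C].
Proof.
elim: s => [|j s IHs] gf fe fd.
  rewrite !big_nil; split.
  - exists 1, 0; split; first lra.
    by case=> [|n]; rewrite /= ?Cmod_1 ?Cmod_0; [lra|rewrite Rmult_0_l Rmult_0_r; lra].
  - exact: (is_series_single (f := fun n => (n == 0%N)%:R%R)).
  - rewrite [X in is_series _ X](_ : _ = RtoC (INR 0) * (0%N == 0%N)%:R%R)%C; last first.
      by rewrite Cmult_0_l Cmult_0_r.
    by apply: (is_series_single (f := fun n => (RtoC (INR n) * (n == 0%N)%:R%R)%C)) => n;
      rewrite Cmult_0_r.
have js : j \in j :: s := mem_head _ _.
have sub i : i \in s -> i \in j :: s by move=> si; rewrite inE si orbT.
have [gs es ds] := IHs (fun i si => gf i (sub i si)) (fun i si => fe i (sub i si)) (fun i si =>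
  fd i (sub i si)).
rewrite !big_cons /=; split.
- exact: geo_conv (gf j js) gs.
- exact: is_series_conv (gf j js) gs (fe j js) es.
have := is_series_plus _ _ _ _ (is_series_conv (geo_INR_mult (gf j js)) gs (fd j js) es)
  (is_series_conv (gf j js) (geo_INR_mult gs) (fe j js) ds).
move=> H.
have -> : ((e j * \prod_(i <- s) e i)%R * (d j + \sum_(i <- s) d i)%R)%C
    = plus (e j * d j * (\prod_(i <- s) e i)%R)%C (e j * ((\prod_(i <- s) e i)%R * (\sum_(i <- s) d
      i)%R))%C.
  move: (\prod_(i <- s) e i)%R (\sum_(i <- s) d i)%R => p t.
  by rewrite /plus /= -[LHS]/(e j * p * (d j + t))%C; ring.
by apply: is_series_ext H => n; rewrite conv_INR_mult.
Qed.

End GeometricDecay.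

(** * The complex binomial series *)

Section BinomialSeries.

(** Differentiation in a real parameter is enough: the binomial series is followed along the segment
    from 1 to 1 + w. *)
Definition is_derive_C (F : R -> C) (x : R) (d : C) : Prop :=
  is_derive (fun t => Re (F t)) x (Re d) /\ is_derive (fun t => Im (F t)) x (Im d).

Lemma is_derive_C_mult (F G : R -> C) (x : R) (d e : C) :
  is_derive_C F x d -> is_derive_C G x e ->
  is_derive_C (fun t => F t * G t)%C x (d * G x + F x * e)%C.
Proof.
move=> [f1 f2] [g1 g2]; split.
  have := is_derive_minus _ _ _ _ _ (is_derive_mult _ _ _ _ _ f1 g1 Rmult_comm) (is_derive_mult _ _
    _ _ _ f2 g2 Rmult_comm).
  rewrite (_ : minus _ _ = Re (d * G x + F x * e)%C) //.
  by rewrite /minus /plus /opp /mult /Re /Im /=; ring.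
have := is_derive_plus _ _ _ _ _ (is_derive_mult _ _ _ _ _ f1 g2 Rmult_comm) (is_derive_mult _ _ _
  _ _ f2 g1 Rmult_comm).
rewrite (_ : plus _ _ = Im (d * G x + F x * e)%C) //.
by rewrite /plus /mult /Re /Im /=; ring.
Qed.

Lemma is_derive_C_scal (c : C) (F : R -> C) (x : R) (d : C) :
  is_derive_C F x d -> is_derive_C (fun t => c * F t)%C x (c * d)%C.
Proof.
move=> Fd; have c0 : is_derive_C (fun _ => c) x (RtoC 0) by split; apply: is_derive_const.
have := is_derive_C_mult c0 Fd.
by rewrite Cmult_0_l Cplus_0_l.
Qed.

Lemma is_derive_C_exp (F : R -> C) (x : R) (d : C) :
  is_derive_C F x d -> is_derive_C (fun t => Cexp (F t)) x (d * Cexp (F x))%C.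
Proof.
move=> [f1 f2]; split; rewrite /Cexp /Re /Im /= -/(Re (F x)) -/(Im (F x)) -/(Re d) -/(Im d).
  have := @is_derive_mult R_AbsRing _ _ _ _ _ (is_derive_comp exp _ _ _ _ (is_derive_exp _) f1)
    (is_derive_comp cos _ _ _ _ (is_derive_cos _) f2) Rmult_comm.
  rewrite (_ : plus _ _
    = Re d * (exp (Re (F x)) * cos (Im (F x))) - Im d * (exp (Re (F x)) * sin (Im (F x)))) //.
  by rewrite /plus /mult /scal /= /mult /=; ring.
have := @is_derive_mult R_AbsRing _ _ _ _ _ (is_derive_comp exp _ _ _ _ (is_derive_exp _) f1)
  (is_derive_comp sin _ _ _ _ (is_derive_sin _) f2) Rmult_comm.
rewrite (_ : plus _ _
  = Re d * (exp (Re (F x)) * sin (Im (F x))) + Im d * (exp (Re (F x)) * cos (Im (F x)))) //.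
by rewrite /plus /mult /scal /= /mult /=; ring.
Qed.

Lemma Cexp_plus (z w : C) : Cexp (z + w)%C = (Cexp z * Cexp w)%C.
Proof.
by apply: C_ext; rewrite /Cexp /Re /Im /= exp_plus ?cos_plus ?sin_plus; ring.
Qed.

Lemma Cexp_0 : Cexp (RtoC 0) = RtoC 1.
Proof. by rewrite Cexp_RtoC exp_0. Qed.

Lemma Cexp_neq0 (z : C) : Cexp z <> RtoC 0.
Proof.
move=> z0; have := Cexp_plus z (- z)%C; rewrite z0 Cplus_opp_r Cexp_0 Cmult_0_l => /RtoC_inj; lra.
Qed.

(** On the right half plane, which contains every 1 + t w, the argument is an arctangent and can be
    differentiated across the real axis, where [Carg] changes its formula. *)
Lemma Carg_atan (z : C) : 0 < Re z -> Carg z = atan (Im z / Re z).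
Proof.
move=> rz; have z0 : z <> RtoC 0 by move=> E; rewrite E /= in rz; lra.
have m0 : 0 < Cmod z by apply/Cmod_gt_0.
have x0 : 0 < Re z / Cmod z by apply: Rdiv_lt_0_compat.
have sq : sqrt (1 - (Re z / Cmod z)²) = Rabs (Im z) / Cmod z.
  have -> : 1 - (Re z / Cmod z)² = (Rabs (Im z) / Cmod z)².
    have := Cmod2_alt z; rewrite -(pow2_abs (Im z)) /Rsqr => E.
    have -> : Rabs (Im z) / Cmod z * (Rabs (Im z) / Cmod z) = Rabs (Im z) ^ 2 / Cmod z ^ 2
      by field; lra.
    have -> : Rabs (Im z) ^ 2 = Cmod z ^ 2 - Re z ^ 2 by lra.
    by field; lra.
  by apply: sqrt_Rsqr; apply: Rmult_le_pos; [apply: Rabs_pos|apply: Rlt_le;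
    apply: Rinv_0_lt_compat].
have E : acos (Re z / Cmod z) = atan (Rabs (Im z) / Re z).
  by rewrite acos_atan // sq; congr atan; field; lra.
rewrite /Carg; case: Rle_dec => Iz; rewrite E.
  by rewrite Rabs_pos_eq.
by rewrite Rabs_left; [rewrite -atan_opp; congr atan; field|]; lra.
Qed.

Lemma is_derive_C_log (w : C) (x : R) : 0 < 1 + x * Re w ->
  is_derive_C (fun t => (ln (sqrt ((1 + t * Re w) ^ 2 + (t * Im w) ^ 2)),
    atan (t * Im w / (1 + t * Re w))) : C)
    x (w / (1 + RtoC x * w))%C.
Proof.
case: w => u v; rewrite [Re _]/= [Im _]/= => pos.
have p2 : 0 < (1 + x * u) ^ 2 + (x * v) ^ 2.
  by have := pow2_ge_0 (x * v); have := pow_lt _ 2 pos; lra.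
have -> : ((u, v) / (1 + RtoC x * (u, v)))%C
    = ((u * (1 + x * u) + v * (x * v)) / ((1 + x * u) ^ 2 + (x * v) ^ 2),
      v / ((1 + x * u) ^ 2 + (x * v) ^ 2)).
  rewrite (_ : (1 + RtoC x * (u, v))%C = (1 + x * u, x * v)); last by apply: C_ext => /=; ring.
  by apply: C_ext => /=; field; lra.
split.
  change (is_derive (fun t => ln (sqrt ((1 + t * u) ^ 2 + (t * v) ^ 2))) x
    ((u * (1 + x * u) + v * (x * v)) / ((1 + x * u) ^ 2 + (x * v) ^ 2))).
  apply: (is_derive_ext_loc (fun t => ln ((1 + t * u) ^ 2 + (t * v) ^ 2) / 2)).
    have cont : continuous (fun t => (1 + t * u) ^ 2 + (t * v) ^ 2) x.
      by apply: ex_derive_continuous; auto_derive.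
    have near_pos : locally x (fun t => 0 < (1 + t * u) ^ 2 + (t * v) ^ 2).
      exact: cont (open_gt 0 _ p2).
    have half (L : R) : (L + L) / 2 = L by field.
    apply: filter_imp near_pos => t pt.
    have sp := sqrt_lt_R0 _ pt.
    by rewrite -{1}(sqrt_sqrt _ (Rlt_le _ _ pt)) ln_mult // half.
  by auto_derive; [lra|field; lra].
change (is_derive (fun t => atan (t * v / (1 + t * u))) x (v / ((1 + x * u) ^ 2 + (x * v) ^ 2))).
by auto_derive; [lra|field; lra].
Qed.

Variables (al w : C).
Hypothesis w1 : Cmod w < 1.

Let f (n : nat) : C := (Cbinom al n * w ^ n)%C.

Lemma binom_series_rec (n : nat) :
  (RtoC (INR n.+1) * f n.+1)%C = ((al - RtoC (INR n)) * w * f n)%C.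
Proof.
rewrite /f [(w ^ n.+1)%C]/=.
transitivity ((Cbinom al n.+1 * INR n.+1) * w * w ^ n)%C; first by ring.
by rewrite CbinomS; ring.
Qed.

Lemma eventually_decr_bounded (u : nat -> R) (M : nat) :
  (forall n, (M <= n)%N -> u n.+1 <= u n) -> exists K, forall n, u n <= K.
Proof.
elim: M u => [|M IHM] u decr.
  exists (u 0%N); elim=> [|n IHn]; first exact: Rle_refl.
  by apply: Rle_trans IHn; apply: decr.
have [K HK] := IHM (fun n => u n.+1) (fun n Mn => decr n.+1 Mn).
exists (Rmax (u 0%N) K) => -[|n]; first exact: Rmax_l.
exact: Rle_trans (HK n) (Rmax_r _ _).
Qed.

(** Ratio test with r halfway between |w| and 1. The choice of M gives (r - |w|) n >= 1 + |al| for n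
    >= M, so the ratio (n + |al|) |w| / (n + 1) is at most r. *)
Lemma geo_binom_series : geo f.
Proof.
pose r := (1 + Cmod w) / 2; have w0 := Cmod_ge_0 w; have a0 := Cmod_ge_0 al.
have r0 : 0 < r by rewrite /r; lra.
have rw : 0 < r - Cmod w by rewrite /r; lra.
have [M [HM M0]] := archimed_cor1 ((r - Cmod w) / (1 + Cmod al)) (Rdiv_lt_0_compat _ _ rw
  (ltac:(lra) : 0 < 1 + Cmod al)).
have [|K HK] := @eventually_decr_bounded (fun n => Cmod (f n) / r ^ n) M.
  move=> n /leP Mn; have nM := le_INR _ _ Mn.
  have M0' : 0 < INR M by apply: lt_0_INR.
  have n0 : 0 < INR n.+1 by apply: lt_0_INR; lia.
  have key : (INR n + Cmod al) * Cmod w <= r * INR n.+1.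
    have : (r - Cmod w) * INR M >= 1 + Cmod al.
      have := Rmult_lt_compat_r _ _ _ M0' HM; rewrite Rinv_l; last by lra.
      move=> h; apply: Rle_ge; apply: (Rmult_le_reg_r (/ (1 + Cmod al))).
        by apply: Rinv_0_lt_compat; lra.
      by rewrite Rinv_r; [rewrite /Rdiv in h; lra|lra].
    rewrite S_INR => h; have : (r - Cmod w) * INR n >= 1 + Cmod al by nra.
    have : Cmod al * Cmod w <= Cmod al by nra.
    by nra.
  have rn : 0 < r ^ n by apply: pow_lt.
  have E : INR n.+1 * Cmod (f n.+1) <= (INR n + Cmod al) * Cmod w * Cmod (f n).
    have <- : Cmod (RtoC (INR n.+1)) = INR n.+1 by rewrite Cmod_R Rabs_pos_eq; lra.
    rewrite -Cmod_mult binom_series_rec (Cmod_mult _ (f n)) (Cmod_mult _ w).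
    apply: Rmult_le_compat_r; first exact: Cmod_ge_0.
    apply: Rmult_le_compat_r => //; apply: Rle_trans (Cmod_triangle _ _) _.
    by rewrite Cmod_opp Cmod_R Rabs_pos_eq; [lra|apply: pos_INR].
  have f0 := Cmod_ge_0 (f n).
  have E2 : INR n.+1 * Cmod (f n.+1) <= INR n.+1 * (r * Cmod (f n)) by nra.
  have E3 := Rmult_le_reg_l _ _ _ n0 E2.
  apply/Rle_div_l; first exact: pow_lt.
  by rewrite -tech_pow_Rmult; have -> : Cmod (f n) / r ^ n * (r * r ^ n) = r * Cmod (f n)
    by field; lra.
exists K, r; split; first by rewrite /r; lra.
by move=> n; have := HK n; move/Rle_div_l; apply; apply: pow_lt.
Qed.

(** The point y = 2 / (1 + r) satisfies y > 1 and r y <= 1, so the terms stay bounded there. The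
    endpoint 1 is thus interior and requires no Abel summation. *)
Lemma lt_CV_geo (a : nat -> R) (x : R) :
  (forall n, Rabs (a n) <= Cmod (f n)) -> Rabs x <= 1 -> Rbar_lt (Rabs x) (CV_radius a).
Proof.
move=> af x1; have [K [r [r01 fK]]] := geo_binom_series.
pose y := 2 / (1 + r); have y1 : 1 < y by apply/Rlt_div_r; lra.
have ry : 0 <= r * y <= 1.
  by split; [apply: Rmult_le_pos; lra|rewrite /y -Rmult_assoc; apply/Rle_div_l; lra].
apply: (@Rbar_lt_le_trans _ y); first by rewrite /=; lra.
apply: (CV_radius_bounded a).1; exists K => n.
have K0 : 0 <= K by have := fK 0%N; have := Cmod_ge_0 (f 0%N); rewrite /=; lra.
rewrite Rabs_mult (Rabs_pos_eq (y ^ n)); last by apply: pow_le; lra.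
apply: (@Rle_trans _ (K * r ^ n * y ^ n)).
  apply: Rmult_le_compat_r; first by apply: pow_le; lra.
  exact: Rle_trans (af n) (fK n).
rewrite Rmult_assoc -Rpow_mult_distr -[X in _ <= X]Rmult_1_r; apply: Rmult_le_compat_l => //.
by rewrite -(pow1 n); apply: pow_incr.
Qed.

Let fr (n : nat) : R := Re (f n).
Let fi (n : nat) : R := Im (f n).
Let Y (x : R) : C := (PSeries fr x, PSeries fi x).

Lemma Re_pos (x : R) : 0 <= x <= 1 -> 0 < 1 + x * Re w.
Proof.
move=> x01; have := Rle_lt_trans _ _ _ (re_le_Cmod w) w1 => /Rabs_def2 [_ rw].
by case: (Rle_lt_dec 0 (Re w)) => ?; nra.
Qed.

(** Summing [binom_series_rec] gives Y' = al w Y - w x Y', that is, (1 + x w) Y' = al w Y. *)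
Lemma is_derive_binom_series (x : R) : 0 <= x <= 1 ->
  is_derive_C Y x (al * (w / (1 + RtoC x * w)) * Y x)%C.
Proof.
move=> x01; have ax : Rabs x <= 1 by rewrite Rabs_pos_eq; lra.
have rr := lt_CV_geo (fun n => re_le_Cmod (f n)) ax.
have ri := lt_CV_geo (fun n => Im_le_Cmod (f n)) ax.
pose dY : C := (PSeries (PS_derive fr) x, PSeries (PS_derive fi) x).
suff <- : dY = (al * (w / (1 + RtoC x * w)) * Y x)%C by split; apply: is_derive_PSeries.
have nz : (1 + RtoC x * w)%C <> RtoC 0.
  by move=> /(congr1 Re) /=; have := Re_pos x01; rewrite /Re /=; lra.
suff E : ((1 + RtoC x * w) * dY)%C = (al * w * Y x)%C.
  have -> : (al * (w / (1 + RtoC x * w)) * Y x)%C = (al * w * Y x / (1 + RtoC x * w))%C by field.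
  by rewrite -E; field.
have yr : is_pseries fr x (Re (Y x)) by apply: PSeries_correct; apply: CV_radius_inside.
have yi : is_pseries fi x (Im (Y x)) by apply: PSeries_correct; apply: CV_radius_inside.
have dr : is_pseries (PS_derive fr) x (Re dY).
  by apply: PSeries_correct; apply: CV_radius_inside; rewrite CV_radius_derive.
have di : is_pseries (PS_derive fi) x (Im dY).
  by apply: PSeries_correct; apply: CV_radius_inside; rewrite CV_radius_derive.
have xr := is_pseries_incr_1 _ _ _ dr; have xi := is_pseries_incr_1 _ _ _ di.
(* Suitable real scalars make this the real, then the imaginary part of al w Y - w x Y'. *)
have comb (c1 c2 c3 c4 : R) := is_pseries_minus _ _ _ _ _
  (is_pseries_plus _ _ _ _ _ (is_pseries_scal c1 _ _ _ (Rmult_comm _ _) yr) (is_pseries_scal c2 _ _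
    _ (Rmult_comm _ _) yi))
  (is_pseries_plus _ _ _ _ _ (is_pseries_scal c3 _ _ _ (Rmult_comm _ _) xr) (is_pseries_scal c4 _ _
    _ (Rmult_comm _ _) xi)).
have incr (n : nat) : PS_incr_1 (PS_derive fr) n = INR n * fr n /\ PS_incr_1 (PS_derive fi) n
  = INR n * fi n.
  by case: n => [|n]; rewrite /PS_incr_1 /PS_derive /= ?Rmult_0_l.
have rec (n : nat) : PS_derive fr n = Re ((al - RtoC (INR n)) * w * f n)%C /\ PS_derive fi n
  = Im ((al - RtoC (INR n)) * w * f n)%C.
  by rewrite -binom_series_rec Re_RtoC_mult Im_RtoC_mult.
have Er : Re dY = Re (al * w * Y x)%C - x * (Re w * Re dY - Im w * Im dY).
  rewrite -[LHS](is_pseries_unique _ _ _ dr); apply: is_pseries_unique.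
  have := comb (Re (al * w)%C) (- Im (al * w)%C) (Re w) (- Im w).
  rewrite (_ : plus _ (opp _) = Re (al * w * Y x)%C - x * (Re w * Re dY - Im w * Im dY));
    last first.
    by rewrite /minus /plus /opp /scal /= /mult /Re /Im /=; ring.
  apply: is_pseries_ext => n;
    rewrite (rec n).1 /PS_minus /PS_plus /PS_opp /PS_scal (incr n).1 (incr n).2.
  by rewrite /plus /opp /scal /= /mult /fr /fi /Re /Im /=; ring.
have Ei : Im dY = Im (al * w * Y x)%C - x * (Im w * Re dY + Re w * Im dY).
  rewrite -[LHS](is_pseries_unique _ _ _ di); apply: is_pseries_unique.
  have := comb (Im (al * w)%C) (Re (al * w)%C) (Im w) (Re w).
  rewrite (_ : plus _ (opp _) = Im (al * w * Y x)%C - x * (Im w * Re dY + Re w * Im dY));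
    last first.
    by rewrite /minus /plus /opp /scal /= /mult /Re /Im /=; ring.
  apply: is_pseries_ext => n;
    rewrite (rec n).2 /PS_minus /PS_plus /PS_opp /PS_scal (incr n).1 (incr n).2.
  by rewrite /plus /opp /scal /= /mult /fr /fi /Re /Im /=; ring.
move: (dY) Er Ei => -[d1 d2]; rewrite [Re (d1, d2)]/= [Im (d1, d2)]/= => Er Ei.
apply: C_ext; [move: Er|move: Ei]; move: (al * w * Y x)%C => -[z1 z2]; rewrite /Re /Im /=; lra.
Qed.

(** Y(t) exp(- al Log(1 + t w)) has derivative 0 on [0, 1] and equals 1 at t = 0. *)
Lemma is_series_binomial :
  is_series (K := C_AbsRing) (V := C_NormedModule) f (Cpower (1 + w) al)%C.
Proof.
have x0 : 0 <= 0 <= 1 by lra.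
pose L (t : R) : C := (ln (sqrt ((1 + t * Re w) ^ 2 + (t * Im w) ^ 2)),
  atan (t * Im w / (1 + t * Re w))).
pose M (t : R) : C := (Y t * Cexp (- al * L t))%C.
have dM t : 0 <= t <= 1 -> is_derive_C M t (RtoC 0).
  move=> t01; have dL := is_derive_C_log (Re_pos t01).
  have := is_derive_C_mult (is_derive_binom_series t01) (is_derive_C_exp (is_derive_C_scal (- al)%C
    dL)).
  by rewrite (_ : (_ + _)%C = RtoC 0) //; ring.
have L1 : L 1 = Clog (1 + w)%C.
  rewrite /L /Clog Carg_atan /Cmod /=; last by have := Re_pos (x := 1); rewrite /Re /=; lra.
  by congr (ln (sqrt _), atan _); rewrite /Re /Im /=; field; have := Re_pos (x := 1);
    rewrite /Re /=; lra.
have L0 : L 0 = RtoC 0.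
  rewrite /L !Rmult_0_l /Rdiv Rmult_0_l atan_0 (_ : (1 + 0) ^ 2 + 0 ^ 2 = 1); last ring.
  by rewrite sqrt_1 ln_1.
have Y0 : Y 0 = RtoC 1.
  by rewrite /Y !PSeries_0 /fr /fi /f /Cbinom big_ord0 /=; apply: C_ext; rewrite /Re /Im /=; field.
have ME : M 1 = M 0.
  apply: C_ext; symmetry.
    by apply: (eq_is_derive (fun t => Re (M t))); [move=> t /dM []|lra].
  by apply: (eq_is_derive (fun t => Im (M t))); [move=> t /dM []|lra].
have YE : Y 1 = Cpower (1 + w)%C al.
  move: ME; rewrite /M L0 L1 Y0 Cmult_0_r Cexp_0 Cmult_1_l => ME.
  rewrite /Cpower -[RHS]Cmult_1_r -[X in _
    = (_ * X)%C]ME Cmult_assoc (Cmult_comm _ (Y 1)) -Cmult_assoc -Cexp_plus.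
  rewrite (_ : (al * Clog (1 + w) + - al * Clog (1 + w))%C = RtoC 0); last by ring.
  by rewrite Cexp_0 Cmult_1_r.
rewrite -YE; apply/is_series_C_iff.
have pw (a : nat -> R) : (forall n, Rabs (a n) <= Cmod (f n)) -> is_series a (PSeries a 1).
  move=> af; have : is_pseries a 1 (PSeries a 1).
    by apply: PSeries_correct; apply: CV_radius_inside; apply: lt_CV_geo => //; rewrite Rabs_R1;
      lra.
  by apply: is_series_ext => n; rewrite pow_n_pow pow1 /scal /= /mult /= Rmult_1_l.
split; apply: pw => n; [exact: re_le_Cmod|exact: Im_le_Cmod].
Qed.

End BinomialSeries.

(** * Second-order asymptotics *)

Section ConvolutionAsymptotics.

Lemma conv_comm (F : comNzRingType) (f g : nat -> F) (n : nat) : conv f g n = conv g f n.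
Proof.
rewrite /conv (reindex_inj rev_ord_inj); apply: eq_bigr => i _ /=.
by rewrite subSS subKn 1?GRing.mulrC // -ltnS.
Qed.

Lemma binom_coef_rising (s : R) (k : nat) :
  binom_coef (- 1 - RtoC s)%C (RtoC 1) k = RtoC (rising s k).
Proof.
elim: k => [|k IHk]; first exact: binom_coef0.
have n0 : RtoC (INR k.+1) <> RtoC 0 by move=> /RtoC_inj; apply: not_0_INR.
have one0 : RtoC 1 <> RtoC 0 by move=> /RtoC_inj; lra.
have := binom_coefS (- 1 - RtoC s)%C k one0; rewrite Cmult_1_l IHk risingS => E.
have n0' : INR k.+1 <> 0 by apply: not_0_INR.
have -> : binom_coef (- 1 - RtoC s)%C (RtoC 1) k.+1
    = (binom_coef (- 1 - RtoC s) (RtoC 1) k.+1 * INR k.+1 / INR k.+1)%C by field.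
rewrite E (_ : rising s k * _ = (INR k - (-1 - s)) * rising s k / INR k.+1).
  by rewrite RtoC_div // RtoC_mult !RtoC_minus.
by rewrite S_INR in n0' *; field.
Qed.

Section RisingRatio.
Variables (s : R) (k : nat).
Hypotheses (s01 : 0 < s <= 1) (k1 : (1 <= k)%N).

(** Expansion of g_(k-i) / g_k in 1 / k, uniform in i, by induction on i: each step multiplies by 1
    - s / (k - i + s). The exponents 2 and 4 are generous enough for the induction to close, and the
    geometric decay of h absorbs any power of i. *)
Lemma rising_ratio (i : nat) : (i <= k)%N ->
  0 < rising s (k - i)%N / rising s k /\
  0 <= 1 - rising s (k - i)%N / rising s k <= INR i ^ 2 / INR k /\
  Rabs (rising s (k - i)%N / rising s k - 1 + s * INR i / INR k) <= INR i ^ 4 / INR k ^ 2.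
Proof.
have k0 : 0 < INR k by apply: lt_0_INR; apply/ltP.
have gk : 0 < rising s k by apply: rising_pos; lra.
elim: i => [|i IHi] ik.
  have -> : rising s (k - 0)%N / rising s k = 1 by rewrite subn0; field; lra.
  by rewrite /= !Rmult_0_l Rmult_0_r /Rdiv !Rmult_0_l Rminus_diag Rplus_0_l Rabs_R0; lra.
have [p0 [[p1 A] B]] := IHi (ltnW ik).
set p := rising s (k - i)%N / rising s k in p0 p1 A B.
set m := INR (k - i)%N; set t := INR i.
have mE : m = INR k - t by rewrite /m minus_INR //; apply/leP; apply: ltnW.
have m1 : 1 <= m by rewrite /m -[1]/(INR 1); apply: le_INR; apply/leP; rewrite subn_gt0.
have t0 : 0 <= t by apply: pos_INR.
pose x := s / (m + s).
have x0 : 0 <= x by apply: Rmult_le_pos; [lra|apply: Rlt_le; apply: Rinv_0_lt_compat; lra].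
have -> : rising s (k - i.+1)%N / rising s k = p * (1 - x).
  rewrite /p; have -> : (k - i)%N = (k - i.+1).+1 by rewrite subnSK.
  by rewrite risingS subnSK // -/m /x; field; lra.
(* x <= 1 / m, and m (t + 1) >= m + t = k because m >= 1. *)
have x1 : x <= (t + 1) / INR k.
  apply: (@Rle_trans _ (/ m)).
    rewrite /x -[/ m]Rmult_1_l; apply: Rmult_le_compat; try lra.
      by apply: Rlt_le; apply: Rinv_0_lt_compat; lra.
    by apply: Rinv_le_contravar; lra.
  apply/Rle_div_r => //; apply: (Rmult_le_reg_l m); first lra.
  by rewrite -Rmult_assoc Rinv_r; nra.
have xlt1 : x < 1 by apply/Rlt_div_l; lra.
rewrite S_INR -/t.
have ki : 0 < / INR k by apply: Rinv_0_lt_compat.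
split; first by apply: Rmult_lt_0_compat; lra.
split; [split|].
- by nra.
- apply: (@Rle_trans _ (t ^ 2 / INR k + (t + 1) / INR k)).
    have -> : 1 - p * (1 - x) = (1 - p) + p * x by ring.
    by apply: Rplus_le_compat => //; nra.
  have -> : t ^ 2 / INR k + (t + 1) / INR k = (t ^ 2 + t + 1) * / INR k by field; lra.
  by apply: Rmult_le_compat_r; nra.
have d1 : Rabs (x - s / INR k) <= (t + 1) ^ 2 / INR k ^ 2.
  have -> : x - s / INR k = (t - s) * (/ INR k * x) by rewrite /x mE; field; lra.
  rewrite Rabs_mult (Rabs_pos_eq (_ * x)); last by apply: Rmult_le_pos; lra.
  have : Rabs (t - s) <= t + 1 by apply: Rabs_le; lra.
  have : / INR k * x <= / INR k * ((t + 1) / INR k) by apply: Rmult_le_compat_l; lra.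
  have -> : (t + 1) ^ 2 / INR k ^ 2 = (t + 1) * (/ INR k * ((t + 1) / INR k)) by field; lra.
  by move=> h1 h2; apply: Rmult_le_compat => //; [apply: Rabs_pos|apply: Rmult_le_pos; lra].
have d2 : (1 - p) * x <= t ^ 2 * (t + 1) / INR k ^ 2.
  have -> : t ^ 2 * (t + 1) / INR k ^ 2 = (t ^ 2 / INR k) * ((t + 1) / INR k) by field; lra.
  by apply: Rmult_le_compat.
have -> : p * (1 - x) - 1 + s * (t + 1) / INR k
    = (p - 1 + s * t / INR k) + (- (x - s / INR k) + (1 - p) * x) by field; lra.
apply: Rle_trans (Rabs_triang _ _) _.
apply: (@Rle_trans _ (t ^ 4 / INR k ^ 2 + ((t + 1) ^ 2 / INR k ^ 2 + t ^ 2 * (t + 1) / INR k ^ 2))).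
  apply: Rplus_le_compat => //; apply: Rle_trans (Rabs_triang _ _) _.
  by rewrite Rabs_Ropp (Rabs_pos_eq ((1 - p) * x)); [apply: Rplus_le_compat|apply: Rmult_le_pos;
    lra].
have -> : t ^ 4 / INR k ^ 2 + ((t + 1) ^ 2 / INR k ^ 2 + t ^ 2 * (t + 1) / INR k ^ 2)
  = (t ^ 4 + (t + 1) ^ 2 + t ^ 2 * (t + 1)) * / INR k ^ 2 by field; lra.
apply: Rmult_le_compat_r; first by apply: Rlt_le; apply: Rinv_0_lt_compat; apply: pow_lt.
have t2 : 0 <= t ^ 2 by apply: pow_le.
have t3 : 0 <= t ^ 3 by apply: pow_le.
have -> : (t + 1) ^ 4 = t ^ 4 + 4 * t ^ 3 + 6 * t ^ 2 + 4 * t + 1 by ring.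
by nra.
Qed.

End RisingRatio.

Lemma is_series_partial (f : nat -> C) (l : C) :
  is_series (K := C_AbsRing) (V := C_NormedModule) f l ->
  is_lim_seq (fun n => Cmod (l - (\sum_(i < n.+1) f i)%R)%C) 0.
Proof.
move=> /is_series_C_iff [sr si].
have sumE (a : nat -> R) n : sum_n a n = sum_f_R0 a n by apply: sum_n_Reals.
apply: (is_lim_seq_le_le (fun _ => 0) _
   (fun n => Rabs (Re l - sum_n (fun k => Re (f k)) n) + Rabs (Im l - sum_n (fun k =>
     Im (f k)) n))).
- move=> n; split; first exact: Cmod_ge_0.
  rewrite !sumE -Re_sum -Im_sum; set z := (\sum_(i < _) _)%R.
  have -> : (l - z)%C = (RtoC (Re l - Re z) + RtoC (Im l - Im z) * Ci)%C by apply: C_ext;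
    rewrite /Re /Im /=; ring.
  apply: Rle_trans (Cmod_triangle _ _) _.
  by rewrite Cmod_mult Cmod_Ci !Cmod_R Rmult_1_r; apply: Rle_refl.
- exact: is_lim_seq_const.
have sub0 (a : nat -> R) (x : R) : is_series a x -> is_lim_seq (fun n => Rabs (x - sum_n a n)) 0.
  move=> ax; rewrite -Rabs_R0 -(Rminus_diag x); apply: (is_lim_seq_abs _ (x - x)).
  by apply: is_lim_seq_minus'; [apply: is_lim_seq_const|].
by rewrite -(Rplus_0_r 0); apply: is_lim_seq_plus'; apply: sub0.
Qed.

Variables (s : R) (h : nat -> C) (E T : C).
Hypotheses (s01 : 0 < s <= 1) (hg : geo h).
Hypothesis hE : is_series (K := C_AbsRing) (V := C_NormedModule) h E.
Hypothesis hT : is_series (K := C_AbsRing) (V := C_NormedModule) (fun n => RtoC (INR n) * h n)%C T.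

Let g (k : nat) : C := RtoC (rising s k).
Let S (k : nat) : C := (\sum_(i < k.+1) h i)%R.

(* [k |E - S k|] is at most the tail of the convergent series of the [n |h n|]. *)
Lemma tail_lim : is_lim_seq (fun k => INR k * Cmod (E - S k)%C) 0.
Proof.
have gh := geo_INR_mult hg.
have [A hA] : ex_series (fun n => Rabs (Cmod (RtoC (INR n) * h n)%C)).
  by apply: (ex_series_geo_Rabs gh) => n; rewrite Rabs_pos_eq; [apply: Rle_refl|apply: Cmod_ge_0].
pose u n := Rabs (Cmod (RtoC (INR n) * h n)%C).
have uE n : u n = INR n * Cmod (h n).
  rewrite /u Rabs_pos_eq; last exact: Cmod_ge_0.
  by rewrite Cmod_mult Cmod_R Rabs_pos_eq //; apply: pos_INR.
have u0 n : 0 <= u n by apply: Rabs_pos.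
have lim_A : is_lim_seq (sum_n u) A by [].
have le_A n : sum_n u n <= A.
  apply: (is_lim_seq_incr_compare _ _ lim_A) => {}n.
  by rewrite sum_Sn /plus /=; have := u0 n.+1; lra.
have partial k d : INR k * Cmod (S (k + d)%N - S k)%C <= sum_n u (k + d)%N - sum_n u k.
  elim: d => [|d IHd].
    by rewrite addn0 (_ : (S k - S k)%C = RtoC 0) ?Cmod_0; [lra|ring].
  rewrite addnS sum_Sn /plus /= uE.
  have -> : (S (k + d).+1 - S k)%C = ((S (k + d)%N - S k) + h (k + d).+1)%C.
    rewrite {1}/S big_ord_recr -[LHS]/((S (k + d)%N + h (k + d).+1) - S k)%C; ring.
  have := Rmult_le_compat_l _ _ _ (pos_INR k) (Cmod_triangle (S (k + d)%N - S k)%C (h (k + d).+1)).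
  have : INR k * Cmod (h (k + d).+1) <= INR (k + d).+1 * Cmod (h (k + d).+1).
    apply: Rmult_le_compat_r; first exact: Cmod_ge_0.
    by apply: le_INR; apply/leP; rewrite -addnS leq_addr.
  by lra.
have bound k : INR k * Cmod (E - S k)%C <= A - sum_n u k.
  have lim_d : is_lim_seq (fun d =>
    INR k * Cmod (E - S (k + d)%N)%C + (A - sum_n u k)) (A - sum_n u k).
    rewrite -{2}(Rplus_0_l (A - _)) -(Rmult_0_r (INR k)).
    apply: is_lim_seq_plus'; last exact: is_lim_seq_const.
    apply: (is_lim_seq_scal_l _ _ 0).
    apply: (is_lim_seq_ext (fun d => Cmod (E - S (d + k)%N)%C)); first by move=> d; rewrite addnC.
    exact: (proj1 (is_lim_seq_incr_n _ k 0) (is_series_partial hE)).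
  apply: (is_lim_seq_le _ _ (INR k * Cmod (E - S k)%C) (A - sum_n u k) _ (is_lim_seq_const _)
    lim_d) => d.
  have -> : (E - S k)%C = ((E - S (k + d)%N) + (S (k + d)%N - S k))%C by ring.
  have := Rmult_le_compat_l _ _ _ (pos_INR k) (Cmod_triangle (E - S (k + d)%N)%C (S (k + d)%N - S
    k)%C).
  by have := partial k d; have := le_A (k + d)%N; lra.
apply: (is_lim_seq_le_le (fun _ => 0) _ (fun k => A - sum_n u k)).
- by move=> k; split=> //; apply: Rmult_le_pos; [apply: pos_INR|apply: Cmod_ge_0].
- exact: is_lim_seq_const.
rewrite -(Rminus_diag A); apply: is_lim_seq_minus' => //; exact: is_lim_seq_const.
Qed.

Lemma conv_rising_asymptotics :
  is_lim_seq (fun k => Cmod (RtoC (INR k) * (conv g h k / g k - E) + RtoC s * T)%C) 0.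
Proof.
have g4 := geo_INR_mult (geo_INR_mult (geo_INR_mult (geo_INR_mult hg))).
have [A hA] : ex_series (fun n => Rabs (INR n ^ 4 * Cmod (h n))).
  apply: (ex_series_geo_Rabs g4) => n.
  rewrite !Cmod_mult Rabs_mult !Cmod_R (Rabs_pos_eq (Cmod _)); last exact: Cmod_ge_0.
  by rewrite -RPow_abs /=; right; ring.
pose u n := Rabs (INR n ^ 4 * Cmod (h n)).
have le_A n : sum_n u n <= A.
  have lim_A : is_lim_seq (sum_n u) A by [].
  apply: (is_lim_seq_incr_compare _ _ lim_A) => {}n.
  by rewrite sum_Sn /plus /=; have := Rabs_pos (INR n.+1 ^ 4 * Cmod (h n.+1)); rewrite -/(u _); lra.
pose Th k := (\sum_(i < k.+1) (RtoC (INR i) * h i)%C)%R.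
(* After reversal of the convolution the left side is the sum of p_i h_i with |p_i| <= i^4 / k^2,
   and the sum of the i^4 |h_i| is finite. What remains is to replace the partial sums S and Th by E
   and T. *)
have main k : (1 <= k)%N ->
    Cmod (conv g h k / g k - S k + RtoC (s / INR k) * Th k)%C <= A / INR k ^ 2.
  move=> k1; have k0 : 0 < INR k by apply: lt_0_INR; apply/ltP.
  have gk0 : rising s k <> 0 by have := rising_pos k (proj1 s01); lra.
  have gk : g k <> RtoC 0 by move=> /RtoC_inj.
  pose p i := rising s (k - i)%N / rising s k - 1 + s * INR i / INR k.
  have -> : (conv g h k / g k - S k + RtoC (s / INR k) * Th k)%C
    = (\sum_(i < k.+1) (RtoC (p i) * h i)%C)%R.
    rewrite conv_comm.
    transitivity (\sum_(i < k.+1) (h i * g (k - i)%N / g k - h i + RtoC (s / INR k) * (RtoC (INR i)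
      * h i)))%R.
      by rewrite !big_split /= GRing.sumrN -GRing.mulr_suml -GRing.mulr_sumr.
    apply: eq_bigr => i _; rewrite /p RtoC_plus RtoC_minus !RtoC_div //; try lra.
    rewrite RtoC_mult -/(g k) -/(g (k - i)%N).
    have kC : RtoC (INR k) <> RtoC 0 by move=> /RtoC_inj; lra.
    rewrite -[LHS]/(h i * g (k - i)%N / g k - h i + RtoC s / RtoC (INR k) * (RtoC (INR i) * h i))%C.
    by field.
  apply: (@Rle_trans _ (sum_n u k / INR k ^ 2)); last first.
    by apply: Rmult_le_compat_r => //; apply: Rlt_le; apply: Rinv_0_lt_compat; apply: pow_lt.
  have pb (n : nat) : (n <= k)%N -> Cmod (\sum_(i < n.+1) (RtoC (p i) * h i)%C)%R
    <= sum_n u n / INR k ^ 2.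
    have term i : (i <= k)%N -> Cmod (RtoC (p i) * h i)%C <= u i / INR k ^ 2.
      move=> ik; have [_ [_ B]] := rising_ratio s01 k1 ik.
      rewrite Cmod_mult Cmod_R /u Rabs_mult (Rabs_pos_eq (Cmod _)); last exact: Cmod_ge_0.
      rewrite (Rabs_pos_eq (INR i ^ 4)); last by apply: pow_le; apply: pos_INR.
      have := Rmult_le_compat_r _ _ _ (Cmod_ge_0 (h i)) B.
      by rewrite -/(p i) /Rdiv; lra.
    elim: n => [|n IHn] nk.
      by rewrite big_ord_recr big_ord0 sum_O /= GRing.add0r; apply: term.
    rewrite big_ord_recr sum_Sn.
    apply: Rle_trans (Cmod_triangle (\sum_(i < n.+1) (RtoC (p i) * h i)%C)%R (RtoC (p n.+1) * h
      n.+1)%C) _.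
    rewrite /plus /= /Rdiv Rmult_plus_distr_r; apply: Rplus_le_compat.
      by apply: IHn; apply: ltnW.
    by have := term n.+1 nk.
  exact: pb.
apply: (is_lim_seq_le_le_loc (fun _ => 0) _
  (fun k => A / INR k + INR k * Cmod (E - S k)%C + s * Cmod (T - Th k)%C)).
- exists 1%N => k /leP k1; split; first exact: Cmod_ge_0.
  have k0 : 0 < INR k by apply: lt_0_INR; apply/ltP.
  have kC : RtoC (INR k) <> RtoC 0 by move=> /RtoC_inj; lra.
  have -> : (RtoC (INR k) * (conv g h k / g k - E) + RtoC s * T)%C
     = (RtoC (INR k) * (conv g h k / g k - S k + RtoC (s / INR k) * Th k)
        + (- (RtoC (INR k) * (E - S k)) + RtoC s * (T - Th k)))%C.
    by rewrite RtoC_div; [move: (conv g h k / g k)%C => P; field|lra].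
  apply: Rle_trans (Cmod_triangle _ _) _.
  rewrite Rplus_assoc; apply: Rplus_le_compat.
    rewrite Cmod_mult Cmod_R Rabs_pos_eq; last by lra.
    have -> : A / INR k = INR k * (A / INR k ^ 2) by field; lra.
    by apply: Rmult_le_compat_l; [lra|apply: main].
  apply: Rle_trans (Cmod_triangle _ _) _.
  by rewrite Cmod_opp !Cmod_mult !Cmod_R !Rabs_pos_eq; lra.
- exact: is_lim_seq_const.
have -> : 0 = A * 0 + 0 + s * 0 by ring.
apply: is_lim_seq_plus'; first apply: is_lim_seq_plus'.
- apply: (is_lim_seq_scal_l _ A 0); apply: (is_lim_seq_inv _ p_infty) => //.
  exact: is_lim_seq_INR.
- exact: tail_lim.
by apply: (is_lim_seq_scal_l _ s 0); apply: (is_series_partial hT).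
Qed.

End ConvolutionAsymptotics.

(** * Asymptotics of the coefficients when 1 is the dominant root *)

Section Corollary.

(** Summing [binom_coefS] over n gives b t = t - al e for the unknown sum t, so the binomial series
    itself need not be differentiated. *)
Lemma binom_coef_moment (al b e : C) : 1 < Cmod b -> geo (binom_coef al b) ->
  is_series (K := C_AbsRing) (V := C_NormedModule) (binom_coef al b) e ->
  is_series (K := C_AbsRing) (V := C_NormedModule)
    (fun n => RtoC (INR n) * binom_coef al b n)%C (e * (al / (1 - b)))%C.
Proof.
move=> b1 gf fe; have [t ft] := geo_ex_series (geo_INR_mult gf).
have b0 : b <> RtoC 0 by move=> E; rewrite E Cmod_0 in b1; lra.
have nb : (1 - b)%C <> RtoC 0.
  move=> E; have E' : b = RtoC 1 by rewrite (_ : b = 1 - (1 - b))%C; [rewrite E|]; ring.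
  by rewrite E' Cmod_1 in b1; lra.
suff -> : (e * (al / (1 - b)))%C = t by [].
have shift : is_series (K := C_AbsRing) (V := C_NormedModule)
    (fun n => b * (RtoC (INR n.+1) * binom_coef al b n.+1))%C (b * t)%C.
  apply: (is_series_scal (V := C_NormedModule) b); apply: (is_series_incr_1 (fun n =>
    RtoC (INR n) * binom_coef al b n)%C).
  by rewrite (_ : plus t _ = t) // /plus /= Cmult_0_l Cplus_0_r.
have diff : is_series (K := C_AbsRing) (V := C_NormedModule)
    (fun n => b * (RtoC (INR n.+1) * binom_coef al b n.+1))%C (t - al * e)%C.
  have := is_series_minus _ _ _ _ ft (is_series_scal (V := C_NormedModule) al _ _ fe).
  apply: is_series_ext => n; rewrite (Cmult_comm (RtoC (INR n.+1))) binom_coefS //.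
  change (@eq C (RtoC (INR n) * binom_coef al b n - al * binom_coef al b n)%C
    ((RtoC (INR n) - al) * binom_coef al b n)%C).
  by ring.
have E : (b * t)%C = (t - al * e)%C.
  have [r1 i1] := proj1 (is_series_C_iff _ _) shift; have [r2 i2] :=
    proj1 (is_series_C_iff _ _) diff.
  by apply: C_ext; [rewrite -(is_series_unique _ _ r1) (is_series_unique _ _ r2)|rewrite
    -(is_series_unique _ _ i1) (is_series_unique _ _ i2)].
have -> : (e * (al / (1 - b)))%C = (al * e / (1 - b))%C by rewrite /Cdiv; ring.
by have -> : (al * e)%C = (t - b * t)%C; [rewrite E; ring|field].
Qed.

Lemma binom_coef_series (al b : C) : 1 < Cmod b ->
  geo (binom_coef al b) /\
  is_series (K := C_AbsRing) (V := C_NormedModule) (binom_coef al b) (Cpower (1 - 1 / b) al)%C.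
Proof.
move=> b1; have b0 : b <> RtoC 0 by move=> E; rewrite E Cmod_0 in b1; lra.
have w1 : Cmod (- 1 / b)%C < 1.
  rewrite Cmod_div // Cmod_R Rabs_left; last lra.
  by apply/Rlt_div_l; lra.
split; first exact: geo_binom_series.
have -> : (1 - 1 / b)%C = (1 + - 1 / b)%C by rewrite (RtoC_opp 1); field.
exact: is_series_binomial.
Qed.

Lemma Derive_horner_real (p : {poly C}) (F : R -> R) :
  (forall x, (p.[RtoC x])%R = RtoC (F x)) ->
  forall x, (p^`().[RtoC x])%R = RtoC (Derive F x).
Proof.
move=> pF x; have D : is_derive (K := C_AbsRing) (V :=
  C_NormedModule) (horner p) (RtoC x) (p^`().[RtoC x])%R.
  by case: (is_derive_horner p (RtoC x)) => -[l1 l2 l3] D; split=> //; split.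
have [d1 d2] := is_derive_C_real D; apply: C_ext.
  rewrite -[LHS](is_derive_unique _ _ _ d1) /=; apply: Derive_ext => t.
  by rewrite pF.
rewrite -[LHS](is_derive_unique _ _ _ d2) /= -(Derive_const 0 x); apply: Derive_ext => t.
by rewrite pF.
Qed.

(** Read z = phi_(k+1), g = g_k, n = k + 1, y = n^(s-1), a = s (s - 1) / 2 and m = s H'(1) / H(1).
    The three summands are the error on g_k, the error on phi_(k+1) / g_k, and the discrepancy
    between l g / (k y) and its limit 1. *)
Lemma remainder_identity (z E : C) (l g n k y a m : R) :
  E <> RtoC 0 -> l <> 0 -> g <> 0 -> k <> 0 -> y <> 0 ->
  (z / (E / RtoC l) - RtoC (n * y) - RtoC ((a - m) * y))%C =
  ((RtoC (l * g / y - n - a)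
    + RtoC (l * g / (k * y)) * (RtoC k * (z / RtoC g - E) + E * RtoC m) * / E
    + RtoC m * RtoC (1 - l * g / (k * y))) * RtoC y)%C.
Proof.
move=> E0 l0 g0 k0 y0; have nz (x : R) : x <> 0 -> RtoC x <> RtoC 0 by move=> x0 /RtoC_inj.
have ky0 : k * y <> 0 by apply: Rmult_integral_contrapositive.
rewrite /Rdiv !(RtoC_minus, RtoC_mult) !RtoC_inv // !RtoC_mult.
by field; repeat split=> //; apply: nz.
Qed.

Variables (N : nat) (q : nat -> R).
Hypotheses (hN : (1 <= N)%N) (hq_ge0 : forall j : nat, (1 <= j <= N)%N -> 0 <= q j).
Hypothesis hq_deg : q N <> 0.

(** The source of s <= 1: every j q_j is at least q_j. *)
Lemma Derive_polyR_ge : polyR N q 1 <= Derive (polyR N q) 1.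
Proof.
have -> : Derive (polyR N q) 1 = sum_n (fun j => coefq N q j * INR j) N.
  rewrite (Derive_ext _ (fun x => sum_n (fun j => coefq N q j * x ^ j) N)); last by move=> t;
    apply: polyR_sum.
  apply: is_derive_unique; apply: is_derive_sum_n => j _.
  by auto_derive => //; rewrite pow1; ring.
rewrite polyR_sum; apply: sum_n_m_le => -[|j]; first by rewrite /coefq /=; lra.
rewrite pow1; apply: Rmult_le_compat_l; [exact: coefq_ge0|exact: INR_S_ge1].
Qed.

Variable b : 'I_N -> C.
Hypothesis hb_zeros : forall z : C, polyC N q z = polyC N q 1 <-> exists j : 'I_N, z = b j.
Hypothesis hb_distinct : forall i j : 'I_N, i <> j -> b i <> b j.
Variable j1 : 'I_N.
Hypothesis b1 : b j1 = RtoC 1.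
Hypothesis b_gt1 : forall j : 'I_N, j <> j1 -> Cmod (b j) > 1.

Let al (j : 'I_N) : C := expo N q (b j).
Let others : seq 'I_N := [seq j <- index_enum 'I_N | j != j1].
Let D : R := Derive (polyR N q) 1.
Let D2 : R := Derive_n (polyR N q) 2 1.
Let s : R := polyR N q 1 / D.

Lemma D_gt0 : 0 < D.
Proof. by have := Derive_polyR_ge; have := polyR1_gt0 hN hq_ge0 hq_deg; rewrite -/D; lra. Qed.

Lemma s_bounds : 0 < s <= 1.
Proof.
have := D_gt0; have := Derive_polyR_ge; have := polyR1_gt0 hN hq_ge0 hq_deg; rewrite -/D =>
  h1 h2 h3.
by split; [apply: Rdiv_lt_0_compat|apply/Rle_div_l; lra].
Qed.

Lemma perm_others : perm_eq (j1 :: others) (index_enum 'I_N).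
Proof.
rewrite perm_sym /others (eq_filter (a2 := predC1 j1)) // -(rem_filter _ (index_enum_uniq _)).
exact/perm_to_rem/mem_index_enum.
Qed.

Lemma horner_deriv1 : (shifted_polyq N q)^`().[RtoC 1]%R = RtoC D /\
  (shifted_polyq N q)^`()^`().[RtoC 1]%R = RtoC D2.
Proof.
have h0 x : (polyq N q).[RtoC x]%R = RtoC (polyR N q x) by rewrite horner_polyq polyC_RtoC.
rewrite deriv_shifted_polyq; have h1 := Derive_horner_real h0.
by split; [exact: h1|exact: (Derive_horner_real h1 1)].
Qed.

Lemma al_j1 : al j1 = (- 1 - RtoC s)%C.
Proof.
rewrite /al /expo b1 Cmult_1_r polyC_at1 C_derive_polyC -deriv_shifted_polyq horner_deriv1.1
  RtoC_div //.
by have := D_gt0; lra.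
Qed.

Lemma logderiv_solve (c r z : C) : RtoC D = (c * r)%C ->
  (RtoC 2 * c * (r * z) = - (RtoC 2 * RtoC D + RtoC D2) * (RtoC 2 + (- 1 - RtoC s)))%C ->
  z = RtoC ((s - 1) * (2 * D + D2) / (2 * D)).
Proof.
move=> e1 e2; have D0 := D_gt0; have DC : RtoC D <> RtoC 0 by move=> /RtoC_inj; lra.
have C20 : RtoC 2 <> RtoC 0 by move=> /RtoC_inj; lra.
have -> : z = (RtoC 2 * c * (r * z) / (RtoC 2 * RtoC D))%C.
  have -> : (RtoC 2 * c * (r * z))%C = (RtoC 2 * RtoC D * z)%C by rewrite e1; ring.
  by field.
rewrite e2 RtoC_div; last by lra.
rewrite (RtoC_mult (s - 1)) (RtoC_plus (2 * D)) !(RtoC_mult 2) (RtoC_minus s) (RtoC_opp 1).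
have -> : (RtoC 2 + (- (1) - RtoC s))%C = (1 - RtoC s)%C.
  by rewrite (_ : RtoC 2 = (1 + 1)%C); [ring|rewrite -RtoC_plus].
by field.
Qed.

(** The other roots enter only through the polynomial identity near 1, so the sum is real and
    rational in q(1), q'(1), q''(1). *)
Lemma sum_logderiv : (\sum_(j <- others) al j / (1 - b j))%R
  = RtoC ((s - 1) * (2 * D + D2) / (2 * D)).
Proof.
have us : uniq (j1 :: others) by rewrite (perm_uniq perm_others) index_enum_uniq.
have WE : shifted_polyq N q = (lead_coef (shifted_polyq N q) *: rootp b (j1 :: others))%R.
  rewrite {1}(shifted_polyqE hN hq_ge0 hq_deg hb_zeros hb_distinct) !rootpE; congr (_ *: _)%R.
  by apply/perm_big; rewrite perm_sym perm_others.
have id := logdp_identity (al :=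
  al) (uniq_b hb_distinct us) WE (lead_shifted_polyq_neq0 hN hq_ge0 hq_deg) (q1_neq0 hN hq_ge0
  hq_deg) (shifted_polyq0 N q) (expoE q b).
have [e1 e2] := logdp_at1 b1 WE id.
have := horner_logdp_sum al (b := b) (s := others) (x := RtoC 1) => H.
move: e1 e2 => e1; rewrite al_j1 => e2.
have nb1 : {in others, forall j, RtoC 1 != b j}.
  move=> j; rewrite mem_filter => /andP[/eqP jj1 _]; apply/eqP => E.
  by have := b_gt1 jj1; rewrite -E Cmod_1; lra.
rewrite {}H // in e2; move: e1 e2; rewrite horner_deriv1.1 horner_deriv1.2.
set Lam := (\sum_(j <- others) _)%R; set c := lead_coef _; set r := (rootp b others).[_]%R.
rewrite !(C_natrE 2) (_ : INR 2 = 2); last by rewrite /=; ring.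
exact: logderiv_solve.
Qed.

Definition prod_powers : C := (\prod_(j <- others) Cpower (1 - 1 / b j)%C (al j))%R.

Lemma prod_powers_neq0 : prod_powers <> RtoC 0.
Proof.
rewrite /prod_powers; elim: others => [|j t IHt]; first by rewrite big_nil => /RtoC_inj; lra.
by rewrite big_cons; apply: Cmult_neq_0 => //; apply: Cexp_neq0.
Qed.

Variable phi : nat -> C.
Hypothesis phi1 : phi 1 = RtoC 1.
Hypothesis phi_rec : forall k, ((RtoC (polyR N q 1) * phi k.+1) *+ k =
   conv (fun i => RtoC (coefq N q i)) (fun i => phi i.+1) k *+ k.+1)%R.

Let h : nat -> C := conv_prod (fun j => binom_coef (al j) (b j)) others.

Lemma phi_conv (k : nat) : phi k.+1 = conv (fun i => RtoC (rising s i)) h k.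
Proof.
rewrite (coef_conv_prod hN hq_ge0 hq_deg hb_zeros hb_distinct perm_others phi1 phi_rec) /=.
rewrite /conv; apply: eq_bigr => i _; congr (_ * _)%R.
by rewrite -/(al j1) al_j1 b1 binom_coef_rising.
Qed.

Lemma phi_ratio_asymptotics :
  is_lim_seq (fun k => Cmod (RtoC (INR k) * (phi k.+1 / RtoC (rising s k) - prod_powers)
     + RtoC s * (prod_powers * RtoC ((s - 1) * (2 * D + D2) / (2 * D))))%C) 0.
Proof.
have gt1 : {in others, forall j, 1 < Cmod (b j)}.
  by move=> j; rewrite mem_filter => /andP[/eqP jj1 _]; have := b_gt1 jj1; lra.
have [gh hE hT] := @is_series_conv_prod _ (fun j => binom_coef (al j) (b j))
  (fun j => Cpower (1 - 1 / b j)%C (al j)) (fun j => al j / (1 - b j))%C others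
  (fun j js => (binom_coef_series (al j) (gt1 j js)).1)
  (fun j js => (binom_coef_series (al j) (gt1 j js)).2)
  (fun j js => binom_coef_moment (gt1 j js) (binom_coef_series (al j) (gt1 j js)).1
    (binom_coef_series (al j) (gt1 j js)).2).
have := conv_rising_asymptotics s_bounds gh hE hT.
apply: is_lim_seq_ext => k; rewrite phi_conv.
by rewrite [X in (prod_powers * X)%C](_ : _
  = (\sum_(j <- others) al j / (1 - b j))%R) // sum_logderiv.
Qed.

Lemma phi_asymptotics (l : R) : is_Gamma (1 + s) l ->
  let d := polyR N q 1 * (D - polyR N q 1) * (D2 + D) / (2 * D ^ 3) in
  exists eps : nat -> R, is_lim_seq eps 0 /\ forall k, (1 <= k)%N ->
    Cmod (phi k.+1 / (prod_powers / RtoC l) - RtoC (Rpower (INR k.+1) s)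
       - RtoC (d * Rpower (INR k.+1) (s - 1)))%C <= eps k * Rpower (INR k.+1) (s - 1).
Proof.
move=> sl d; have [s0 s1] := s_bounds; have l0 := Gamma_gt0 (conj s0 s1) sl.
have E0 := prod_powers_neq0; set E := prod_powers in E0 *.
pose lam := (s - 1) * (2 * D + D2) / (2 * D).
pose rho k := l * rising s k / Rpower (INR k.+1) s.
pose A k := INR k.+1 * (rho k - 1); pose al0 := s * (s - 1) / 2.
(* The factor (k + 1) / k accounts for the shift between k in [X] and n = k + 1 in the claim. *)
pose r k := rho k * (INR k.+1 / INR k).
pose X k := (RtoC (INR k) * (phi k.+1 / RtoC (rising s k) - E) + RtoC s * (E * RtoC lam))%C.
have dE : d = al0 - s * lam.
  by rewrite /d /al0 /lam /s; field; have := D_gt0; lra.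
have lim_A : is_lim_seq A al0 by apply: (rising_asymptotics (conj s0 s1) sl).
have lim_X : is_lim_seq (fun k => Cmod (X k)) 0 by apply: phi_ratio_asymptotics.
have lim_inv (m : nat) : is_lim_seq (fun k => / INR (m + k)) 0.
  apply: (is_lim_seq_inv _ p_infty) => //.
  apply: (is_lim_seq_ext (fun k => INR (k + m))); first by move=> k; rewrite addnC.
  exact: (proj1 (is_lim_seq_incr_n _ m p_infty) is_lim_seq_INR).
have lim_rho : is_lim_seq rho 1.
  apply: (is_lim_seq_ext (fun k => 1 + A k * / INR (1 + k))).
    by move=> k; rewrite add1n /A; field; have := INR_S_ge1 k; lra.
  have {2}-> : 1 = 1 + al0 * 0 by ring.
  apply: is_lim_seq_plus'; first exact: is_lim_seq_const.
  exact: is_lim_seq_mult'.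
have lim_r : is_lim_seq r 1.
  apply: (is_lim_seq_ext_loc (fun k => rho k * (1 + / INR (0 + k)))).
    exists 1%N => k /leP k1; rewrite add0n /r S_INR; field.
    by have : 0 < INR k; [apply: lt_0_INR; apply/ltP|lra].
  have {2}-> : 1 = 1 * (1 + 0) by ring.
  apply: is_lim_seq_mult' => //; apply: is_lim_seq_plus' => //; exact: is_lim_seq_const.
exists (fun k => Rabs (A k - al0) + Rabs (r k) * Cmod (X k) * / Cmod E + Rabs (s * lam) * Rabs (1 -
  r k)); split.
  have -> : 0 = Rabs (al0 - al0) + Rabs 1 * 0 * / Cmod E + Rabs (s * lam) * Rabs (1 - 1).
    by rewrite !Rminus_diag Rabs_R0; ring.
  apply: is_lim_seq_plus'; first apply: is_lim_seq_plus'.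
  - apply: (is_lim_seq_abs _ (al0 - al0)); apply: is_lim_seq_minus' => //; exact: is_lim_seq_const.
  - apply: is_lim_seq_mult'; last exact: is_lim_seq_const.
    by apply: is_lim_seq_mult' => //; apply: (is_lim_seq_abs _ 1).
  apply: is_lim_seq_mult'; first exact: is_lim_seq_const.
  apply: (is_lim_seq_abs _ (1 - 1)); apply: is_lim_seq_minus' => //; exact: is_lim_seq_const.
move=> k k1; have k0 : 0 < INR k by apply: lt_0_INR; apply/ltP.
have n0 : 0 < INR k.+1 by have := INR_S_ge1 k; lra.
have ps : Rpower (INR k.+1) s = INR k.+1 * Rpower (INR k.+1) (s - 1).
  have {1}-> : s = 1 + (s - 1) by ring.
  by rewrite Rpower_plus Rpower_1.
set y := Rpower (INR k.+1) (s - 1) in ps *; have y0 : 0 < y by apply: exp_pos.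
have gk := rising_pos k s0.
have -> : (phi k.+1 / (E / RtoC l) - RtoC (Rpower (INR k.+1) s) - RtoC (d * y))%C
   = ((RtoC (A k - al0) + RtoC (r k) * X k * / E + RtoC (s * lam) * RtoC (1 - r k)) * RtoC y)%C.
  have rE : r k = l * rising s k / (INR k * y) by rewrite /r /rho ps; field; lra.
  have AE : A k = l * rising s k / y - INR k.+1 by rewrite /A /rho ps; field; lra.
  have XE : X k = (RtoC (INR k) * (phi k.+1 / RtoC (rising s k) - E) + E * RtoC (s * lam))%C.
    by rewrite /X (RtoC_mult s lam); ring.
  by rewrite XE rE AE dE ps; apply: remainder_identity => //; lra.
rewrite Cmod_mult (Cmod_R y) (Rabs_pos_eq y); last by lra.
apply: Rmult_le_compat_r; first lra.
apply: Rle_trans (Cmod_triangle _ _) _; apply: Rplus_le_compat; last first.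
  by rewrite Cmod_mult !Cmod_R; apply: Rle_refl.
apply: Rle_trans (Cmod_triangle _ _) _; apply: Rplus_le_compat; first by rewrite Cmod_R;
  apply: Rle_refl.
by rewrite !Cmod_mult Cmod_inv // Cmod_R; apply: Rle_refl.
Qed.

End Corollary.

Theorem corollary1p3 (N : nat) (hN : (1 <= N)%N)
    (q : nat -> R)
    (hq_ge0 : forall j : nat, (1 <= j <= N)%N -> 0 <= q j)
    (hq_deg : q N <> 0)
    (b : 'I_N -> C)
    (hb_zeros : forall z : C,
        polyC N q z = polyC N q 1 <-> exists j : 'I_N, z = b j)
    (hb_distinct : forall i j : 'I_N, i <> j -> b i <> b j)
    (Phi : C -> C) (hPhi : analytic_solution N q Phi)
    (phi : nat -> C)
    (hphi : forall z : C, Cmod z < 1 ->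
        is_series (K := C_AbsRing) (V := C_NormedModule)
          (fun k : nat => (phi k.+1 * z ^ k.+1)%C) (Phi z)) :
  (forall n : nat, (1 <= n)%N ->
     phi n =
     \big[Cplus/RtoC 0]_(m : {ffun 'I_N -> 'I_n} | (\sum_(j < N) m j == n - 1)%N)
       \big[Cmult/RtoC 1]_(j < N)
         (Cbinom (expo N q (b j)) (m j) * (- 1 / b j) ^ m j)%C)
  /\
  (forall j1 : 'I_N,
     b j1 = RtoC 1 ->
     (forall j : 'I_N, j <> j1 -> Cmod (b j) > 1) ->
     let q1 := polyR N q 1 in
     let dq1 := Derive (polyR N q) 1 in
     let ddq1 := Derive_n (polyR N q) 2 1 in
     let s := q1 / dq1 in
     let d : R := q1 * (dq1 - q1) * (ddq1 + dq1) / (2 * dq1 ^ 3) in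
     let cst : C :=
       (/ Gamma (1 + s)
        * \big[Cmult/RtoC 1]_(j < N | j != j1)
            Cpower (1 - 1 / b j) (expo N q (b j)))%C in
     exists rem : nat -> C,
       is_domin (V := C_NormedModule) eventually
         (fun n : nat => Rpower (INR n) (s - 1)) rem
       /\ (forall n : nat, (1 <= n)%N ->
             phi n =
             (cst * (Rpower (INR n) s
                     + d * Rpower (INR n) (s - 1)
                     + rem n))%C)).
Proof.
have phi1 := solution_phi1 hPhi hphi.
have phi_rec := solution_recurrence hN hq_ge0 hq_deg hPhi hphi.
split.
  case=> // n _; rewrite subn1.
  rewrite (coef_conv_prod hN hq_ge0 hq_deg hb_zeros hb_distinct (perm_refl _) phi1 phi_rec).
  by rewrite conv_prod_ffun.
move=> j1 b1 b_gt1 q1 dq1 ddq1 s d cst.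
have s01 : 0 < s <= 1 by apply: (s_bounds hN hq_ge0 hq_deg).
have s12 : 1 <= 1 + s <= 2 by lra.
have [l sl] := ex_Gamma s12; have l0 := Gamma_gt0 s01 sl.
have cstE : cst = (prod_powers q b j1 / RtoC l)%C.
  by rewrite /cst (is_Gamma_unique sl) /Cdiv Cmult_comm /prod_powers big_filter.
have E0 : prod_powers q b j1 <> RtoC 0 by apply: prod_powers_neq0.
have lC : RtoC l <> RtoC 0 by move=> /RtoC_inj; lra.
have [eps [lim_eps bound]] :=
  phi_asymptotics hN hq_ge0 hq_deg hb_zeros hb_distinct b1 b_gt1 phi1 phi_rec sl.
(* The claimed formula, solved for the remainder; this is possible because the constant is nonzero,
   and leaves only the decay to prove. *)
exists (fun n => phi n / cst - Rpower (INR n) s - RtoC (d * Rpower (INR n) (s - 1)))%C; split;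
  last first.
  by move=> n _; rewrite cstE RtoC_mult; field.
move=> e; have /is_lim_seq_spec/(_ e)[M HM] := lim_eps.
(* With n = k + 1, this ensures both k >= M and k >= 1. *)
exists M.+2 => -[|k] Mk; first by lia.
have k1 : (1 <= k)%N by apply/leP; lia.
have eps_lt : eps k < e.
  by have := HM k; rewrite Rminus_0_r => /(_ _)/Rabs_def2 [|]; [lia|].
have y0 : 0 < Rpower (INR k.+1) (s - 1) by apply: exp_pos.
have := bound k k1; rewrite -cstE => le1.
change (Cmod (phi k.+1 / cst - Rpower (INR k.+1) s - RtoC (d * Rpower (INR k.+1) (s - 1)))%C
  <= e * Rabs (Rpower (INR k.+1) (s - 1))).
rewrite (Rabs_pos_eq (Rpower _ _)); last by lra.
by apply: Rle_trans le1 _; apply: Rmult_le_compat_r; [exact: Rlt_le y0|lra].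
Qed.
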